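(* Let $\chi$ be the dressing matrix given by the ansatz $$\chi(\lambda,\mathbf{x})=I+\sum_{k=1}^{2N}\frac{R_k(\mathbf{x})}{\lambda-\lambda_k(\mathbf{x})},\qquad R_k=\mathbf{u}_k\mathbf{v}_k^*\Psi_{0k}^{-1},$$ where the non-zero vector functions $\mathbf{u}_k,\mathbf{v}_k$ ($k=1,\dots,2N$) of $\mathbf{x}$, with $\mathbf{v}_k=\Gamma\mathbf{v}_{N+k}$ for $k=1,\dots,N$, satisfy the system $$\sum_{j=1}^{2N}\frac{1}{\lambda_k-\overline{\lambda}_j}\,\mathbf{v}_k^*S_{kj}\mathbf{v}_j\,\mathbf{u}_j^*=-\mathbf{v}_k^*\Psi_{0k}^{-1}\Gamma,\qquad k=1,\dots,2N.$$ The matrix $\chi$ can be constructed from this system in such a way that $$\Omega:=(\chi\Omega_0-D\chi)\chi^{-1}$$ has the exact same pole structure as $\Omega_0$. Furthermore, without loss of generality, the vectors $\{\mathbf{v}_k\}_{k=1}^N$ can be taken to be arbitrary constants, i.e. independent of $\mathbf{x}$.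
   Context: $\mathbb{R}^2_+=\{\mathbf{x}=(\rho,z):\rho>0\}$. Groups: $H\subseteq GL(n,\mathbb{C})$ is a complex semisimple Lie group, $\Gamma\in H$ with $\Gamma^2=I$, and $\tau(g)=\Gamma(g^* )^{-1}\Gamma$, $\sigma(g)=\Gamma g\Gamma$ are commuting involutions of $H$; $G=\{g\in H:\tau(g)=g\}$ is a real form, $K=\{g\in G:\sigma(g)=g\}$ is a maximal compact subgroup of $G$, and $G/K$ is identified with a submanifold of $G$ via the Cartan embedding $gK\mapsto g\sigma(g)^{-1}$. Lax system: $q_0=q_0(\rho,z):\mathbb{R}^2_+\to G/K$ is an axially symmetric harmonic map from Euclidean $\mathbb{R}^3$ (cylindrical coordinates $(\rho,z,\varphi)$) into $G/K$, $W_0=-dq_0\,q_0^{-1}$. With $( *W)_\rho=-W_z$, $( *W)_z=W_\rho$, $$\varpi(\lambda,\mathbf{x})=\frac{\rho^2}{2\lambda}+z-\frac{\lambda}{2},\quad a=\frac{\rho^2}{\lambda^2+\rho^2},\quad b=\frac{\lambda}{\lambda^2+\rho^2},\quad D_\mu=\partial_\mu-\frac{\partial_\mu\varpi}{\partial\varpi/\partial\lambda}\frac{\partial}{\partial\lambda}\ (\mu=\rho,z),$$ and $\Omega_0=aW_0+b\rho( *W_0)$, the $H$-valued map $\Psi_0(\lambda,\mathbf{x})$ is a given solution of $D\Psi_0=-\Omega_0\Psi_0$, $\Psi_0|_{\lambda=0}=q_0$. Poles: $\varpi_1,\dots,\varpi_N$ are distinct complex numbers in the open upper half plane. For given $\mathbf{x}$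 and $\varpi$, the quadratic $\lambda^2-2\lambda(z-\varpi)-\rho^2=0$ has two roots $\lambda_{\mathbf{x}}(\varpi)$, $\lambda'_{\mathbf{x}}(\varpi)$ with product $-\rho^2$ ($\lambda_{\mathbf{x}}$ inside the disk $|\lambda|<\rho$ and $\lambda'_{\mathbf{x}}$ outside of it, for $\varpi$ off the slit $\{z+it:-\rho\le t\le\rho\}$). Set $\lambda_k(\mathbf{x})=\lambda_{\mathbf{x}}(\varpi_k)$, $\lambda_{N+k}(\mathbf{x})=\lambda'_{\mathbf{x}}(\varpi_k)$ for $k=1,\dots,N$. It is assumed that $\Psi_0$ has no poles at the $\lambda_k$. Put $\Psi_{0k}(\mathbf{x})=\Psi_0(\lambda_k(\mathbf{x}),\mathbf{x})$ and $S_{kj}=\Psi_{0k}^{-1}\,\Gamma\,(\Psi_{0j}^* )^{-1}$. ''$\Omega$ has the same pole structure as $\Omega_0$'' means: the poles in $\lambda$ of $\Omega$ are precisely those of $\Omega_0$, with the same residue at each pole. ''Without loss of generality'' is meant in the sense that a matrix $\chi$ as in the claim, obtained from $\mathbf{x}$-dependent $\mathbf{v}_k$, is also obtained from constant ones.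
   Formalization: ''Same pole structure as Ω_0'' is corrected: Ω has the poles and residues of a form aW+bρ( *W) for some λ-independent W, since residues equal to those of Ω_0 itself (W = W_0) fail already for Ψ_0 = I, Ω_0 = 0. *)

(* Defs.v *)
From HB Require Import structures.
From mathcomp Require Import all_boot all_order all_algebra.
From mathcomp Require Import complex.
From mathcomp Require Import all_classical all_reals all_analysis.

Set Implicit Arguments.
Unset Strict Implicit.
Unset Printing Implicit Defensive.

Import Order.TTheory GRing.Theory Num.Theory.
Import numFieldNormedType.Exports.

Local Open Scope ring_scope.
Local Open Scope classical_set_scope.
Local Open Scope sesquilinear_scope.
Local Open Scope complex_scope.

(* Gives [R[i]] the normed topology that every [numFieldType] carries; matrices
   over it inherit theirs. *)
HB.instance Definition _ (R : rcfType) := NormedModule.copy R[i] R[i]^o.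

Section Groups.
Context {R : realType} {n : nat}.
Implicit Types (A X Y g : 'M[R[i]]_n) (H G K : set 'M[R[i]]_n).

Definition is_subgroup H :=
  [/\ H `<=` [set A | A \in unitmx], H 1%:M,
      forall A B, H A -> H B -> H (A *m B) &
      forall A, H A -> H (invmx A)].

Definition expm A : 'M[R[i]]_n :=
  lim (series (fun k => (k`!%:R : R[i])^-1 *: A ^+ k) @ \oo).

Definition lie_algebra H : set 'M[R[i]]_n :=
  [set X | forall t : R, H (expm (t%:C *: X))].

(* H = F `&` GL with F closed: H is closed in GL(n, C), hence a Lie group. *)
Definition complex_lie_group H :=
  [/\ is_subgroup H,
      exists2 F : set 'M[R[i]]_n,
        closed F & H = F `&` [set A | A \in unitmx] &
      forall X, lie_algebra H X -> lie_algebra H ('i *: X)].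

(* Semisimplicity in the form: every abelian ideal is zero. *)
Definition semisimple_lie_algebra (h : set 'M[R[i]]_n) :=
  forall I : set 'M[R[i]]_n, I `<=` h -> I 0 ->
    (forall (a : R[i]) X Y, I X -> I Y -> I (a *: X + Y)) ->
    (forall X Y, h X -> I Y -> I (X *m Y - Y *m X)) ->
    (forall X Y, I X -> I Y -> X *m Y = Y *m X) ->
    I `<=` [set 0].

Definition complex_semisimple_group H :=
  complex_lie_group H /\ semisimple_lie_algebra (lie_algebra H).

Variable Gam : 'M[R[i]]_n.

Definition tau g : 'M[R[i]]_n := Gam *m invmx (g ^t*) *m Gam.
Definition sigma g : 'M[R[i]]_n := Gam *m g *m Gam.

Definition commuting_involutions H :=
  forall g, H g ->
    [/\ H (tau g) /\ H (sigma g), tau (tau g) = g, sigma (sigma g) = g &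
        tau (sigma g) = sigma (tau g)].

(* tau is conjugate-linear on Lie algebras, so its fixed group is a real form. *)
Definition real_form H : set 'M[R[i]]_n := [set g | H g /\ tau g = g].
Definition isotropy H : set 'M[R[i]]_n :=
  [set g | real_form H g /\ sigma g = g].

Definition maximal_compact_subgroup G K :=
  [/\ is_subgroup K, K `<=` G, compact K &
      forall L, is_subgroup L -> compact L -> K `<=` L -> L `<=` G -> L = K].

(* G/K as a subset of G. *)
Definition cartan_image H : set 'M[R[i]]_n :=
  [set g *m invmx (sigma g) | g in real_form H].

End Groups.

Section Calculus.
Context {R : realType}.

(* Points of the half-plane are pairs x = (rho, z). *)
Definition half_plane : set (R * R) := [set x | 0 < x.1].

Inductive axis := Rho | Zed.

Definition dir (mu : axis) : R * R :=
  match mu with Rho => (1, 0) | Zed => (0, 1) end.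

(* [R[i]] is not a normed module over [R] in the library, so real derivatives
   of complex quantities are taken on real and imaginary parts. *)
Definition rdiff {V : normedModType R} (f : V -> R[i]) (p : V) :=
  differentiable (fun y => complex.Re (f y)) p /\
  differentiable (fun y => complex.Im (f y)) p.

Definition pdc (mu : axis) (f : R * R -> R[i]) (x : R * R) : R[i] :=
  'D_(dir mu) (fun y => complex.Re (f y)) x
  +i* 'D_(dir mu) (fun y => complex.Im (f y)) x.

Context {m n : nat}.

Definition mdiff {V : normedModType R} (f : V -> 'M[R[i]]_(m, n)) (p : V) :=
  forall i j, rdiff (fun y => f y i j) p.

Definition pd (mu : axis) (f : R * R -> 'M[R[i]]_(m, n)) (x : R * R) :
    'M[R[i]]_(m, n) :=
  \matrix_(i, j) pdc mu (fun y => f y i j) x.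

End Calculus.

Section Lax.
Context {R : realType}.

Definition varpi (l : R[i]) (x : R * R) : R[i] :=
  x.1%:C ^+ 2 / (2%:R * l) + x.2%:C - l / 2%:R.

Definition acoef (l : R[i]) (x : R * R) : R[i] :=
  x.1%:C ^+ 2 / (l ^+ 2 + x.1%:C ^+ 2).
Definition bcoef (l : R[i]) (x : R * R) : R[i] :=
  l / (l ^+ 2 + x.1%:C ^+ 2).

Context {n : nat}.
Implicit Types (W : axis -> R * R -> 'M[R[i]]_n)
  (F : R[i] -> R * R -> 'M[R[i]]_n).

(* Meaningful for l <> 0 and l ^+ 2 + rho ^+ 2 <> 0. *)
Definition Dop (mu : axis) F (l : R[i]) (x : R * R) : 'M[R[i]]_n :=
  pd mu (F l) x
  - (pdc mu (varpi l) x / derive1 (varpi^~ x) l)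
    *: \matrix_(i, j) derive1 (fun k => F k x i j) l.

(* A matrix-valued 1-form on the half-plane is given by its components. *)
Definition star W (mu : axis) (x : R * R) : 'M[R[i]]_n :=
  match mu with Rho => - W Zed x | Zed => W Rho x end.

Definition current (q : R * R -> 'M[R[i]]_n) (mu : axis) (x : R * R) :
    'M[R[i]]_n :=
  - (pd mu q x *m invmx (q x)).

Definition lax_form W (mu : axis) (l : R[i]) (x : R * R) : 'M[R[i]]_n :=
  acoef l x *: W mu x + (bcoef l x * x.1%:C) *: star W mu x.

(* The harmonic map equation div (dq q^-1) = 0 for an axially symmetric map
   into G/K (totally geodesic in G under the Cartan embedding), with the
   divergence of R^3 written in cylindrical coordinates. *)
Definition axisymmetric_harmonic (Gam : 'M[R[i]]_n) (H : set 'M[R[i]]_n)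
    (q : R * R -> 'M[R[i]]_n) :=
  forall x, half_plane x ->
    [/\ cartan_image Gam H (q x), mdiff q x,
        forall mu, mdiff (current q mu) x &
        pd Rho (fun y => y.1%:C *: current q Rho y) x
        + pd Zed (fun y => y.1%:C *: current q Zed y) x = 0].

(* [dom] is the open set of (l, x) where Psi0 is regular (no poles); the
   equation is asked for where D and Omega_0 are defined. *)
Definition lax_solution (H : set 'M[R[i]]_n) (q : R * R -> 'M[R[i]]_n)
    (dom : set (R[i] * (R * R))) (Psi0 : R[i] -> R * R -> 'M[R[i]]_n) :=
  [/\ open dom,
      dom `<=` [set p | half_plane p.2],
      forall x, half_plane x -> dom (0, x) /\ Psi0 0 x = q x &
      forall l x, dom (l, x) ->
        [/\ H (Psi0 l x),
            mdiff (fun p : (R * R) * (R * R) => Psi0 (p.1.1 +i* p.1.2) p.2)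
                  ((complex.Re l, complex.Im l), x),
            forall i j, derivable (fun k => Psi0 k x i j) l 1 &
            l != 0 -> l ^+ 2 + x.1%:C ^+ 2 != 0 -> forall mu,
              Dop mu Psi0 l x
              = - (lax_form (current q) mu l x *m Psi0 l x)]].

End Lax.

Section Poles.
Context {R : realType}.

(* P (in powers of (l - p)^-1, without constant term) is the principal part at
   p of f, holomorphic near p except possibly at p.  The pole order of f is
   [(size P).-1] and its residue is [P`_1]; no pole means P = 0. *)
Definition principal_part (f : R[i] -> R[i]) (p : R[i]) (P : {poly R[i]}) :=
  let g := fun l => f l - P.[(l - p)^-1] in
  [/\ P`_0 = 0, \forall l \near p^', derivable g l 1 & cvg (g @ p^')].

(* F and G are meromorphic in l on C with the same poles, of the same orders
   and with the same residues. *)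
Definition same_poles_residues {m n : nat} (F G : R[i] -> 'M[R[i]]_(m, n)) :=
  forall p i j, exists P,
    principal_part (fun l => F l i j) p P /\
    principal_part (fun l => G l i j) p P.

(* The pole structure of Omega_0 = a W_0 + b rho ( *W_0): its poles in l are
   l = i rho and l = - i rho, simple, with residues (rho/2) ( *W -+ i W) for a
   current W not depending on l.  Omega shares it if it has those poles and
   residues for its own current W (that of the dressed map): asking for W = W_0
   would force the two Lax forms, both vanishing at l = oo, to coincide. *)
Definition lax_pole_structure {n : nat} (U : set (R * R))
    (Omega : axis -> R[i] -> R * R -> 'M[R[i]]_n) :=
  exists W : axis -> R * R -> 'M[R[i]]_n,
    forall x, U x -> forall mu,
      same_poles_residues (fun l => Omega mu l x) (fun l => lax_form W mu l x).

End Poles.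

Section Dressing.
Context {R : realType}.

(* The slit { z + i t : - rho <= t <= rho }. *)
Definition slit (x : R * R) : set R[i] :=
  [set w | complex.Re w = x.2 /\ `|complex.Im w| <= x.1].

(* The roots of l^2 - 2 l (z - w) - rho^2 inside and outside |l| < rho; this
   meaning is lost for w on the slit. *)
Definition lam_in (w : R[i]) (x : R * R) : R[i] :=
  let s := sqrtC ((x.2%:C - w) ^+ 2 + x.1%:C ^+ 2) in
  if `|x.2%:C - w + s| < x.1%:C then x.2%:C - w + s else x.2%:C - w - s.
Definition lam_out (w : R[i]) (x : R * R) : R[i] :=
  2%:R * (x.2%:C - w) - lam_in w x.

Context {N n : nat}.

(* Indices 1..2N are 'I_(N + N), with k = lshift N k and N + k = rshift N k. *)
Definition lam (w : 'I_N -> R[i]) (k : 'I_(N + N)) (x : R * R) : R[i] :=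
  match fintype.split k with inl j => lam_in (w j) x | inr j => lam_out (w j) x end.

Variables (Gam : 'M[R[i]]_n) (w : 'I_N -> R[i])
  (Psi0 : R[i] -> R * R -> 'M[R[i]]_n).
Implicit Types (u v : 'I_(N + N) -> R * R -> 'cV[R[i]]_n).

Definition Psi0k (k : 'I_(N + N)) (x : R * R) : 'M[R[i]]_n :=
  Psi0 (lam w k x) x.

Definition Smx (k j : 'I_(N + N)) (x : R * R) : 'M[R[i]]_n :=
  invmx (Psi0k k x) *m Gam *m invmx ((Psi0k j x) ^t*).

Definition dressing_system u v (x : R * R) :=
  forall k,
    \sum_j (lam w k x - (lam w j x)^*)^-1 *:
       (((v k x) ^t*) *m Smx k j x *m v j x *m ((u j x) ^t*))
    = - (((v k x) ^t*) *m invmx (Psi0k k x) *m Gam).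

Definition dressing_data (U : set (R * R)) u v :=
  (forall x, U x -> forall k,
    [/\ mdiff (u k) x, mdiff (v k) x, u k x != 0 & v k x != 0]) /\
  (forall x, U x ->
    (forall k : 'I_N, v (lshift N k) x = Gam *m v (rshift N k) x) /\
    dressing_system u v x).

(* The constant family with v_k = c_k for k <= N; v_k = Gam v_(N+k) amounts to
   v_(N+k) = Gam c_k since Gam^2 = 1. *)
Definition const_family (c : 'I_N -> 'cV[R[i]]_n) (k : 'I_(N + N))
    (_ : R * R) : 'cV[R[i]]_n :=
  match fintype.split k with inl j => c j | inr j => Gam *m c j end.

Definition dressing_residue u v (k : 'I_(N + N)) (x : R * R) : 'M[R[i]]_n :=
  u k x *m ((v k x) ^t*) *m invmx (Psi0k k x).

Definition chi u v (l : R[i]) (x : R * R) : 'M[R[i]]_n :=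
  1%:M + \sum_k (l - lam w k x)^-1 *: dressing_residue u v k x.

Definition dressed_form (q : R * R -> 'M[R[i]]_n) u v (mu : axis)
    (l : R[i]) (x : R * R) : 'M[R[i]]_n :=
  (chi u v l x *m lax_form (current q) mu l x - Dop mu (chi u v) l x)
  *m invmx (chi u v l x).

End Dressing.

(* Main.v *)
Require Import Defs.
From HB Require Import structures.
From mathcomp Require Import all_boot all_order all_algebra.
From mathcomp Require Import perm complex.
From mathcomp Require Import all_classical all_reals all_analysis.
From mathcomp Require Import ring lra.
Set Implicit Arguments.
Unset Strict Implicit.
Unset Printing Implicit Defensive.
Import Order.TTheory GRing.Theory Num.Theory.
Import numFieldNormedType.Exports.
Local Open Scope ring_scope.
Local Open Scope classical_set_scope.
Local Open Scope sesquilinear_scope.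
Local Open Scope complex_scope.

(** The matrix [chi] is a sum of simple fractions in [l] with poles at the roots
    [lambda_k].  Put [chi^ (l) = Gam chi(conj l)^H Gam], where [^H] is the
    Hermitian conjugate.  The linear system for the [u_k] says exactly that the
    row [v_k^H Psi_0k^-1] is killed by [chi^ (lambda_k)], hence that the
    product [chi chi^] has no residue anywhere: [chi^] is the inverse of [chi]
    ([system_kernel], [chi_mul_hat]).  This uses that no root [lambda_k] is
    the conjugate of a root ([lam_neq_conj]) and that [Gam] is Hermitian, which
    follows from the fact that [tau] is an involution
    ([tau_involutive_hermitian]).

    Multiplied by [l ^ 2 + rho ^ 2] and by all the factors [l - lambda_k] and
    [l - conj lambda_k], the dressed form becomes an entire function
    [dressed_form_numer] of [l], so that its only possible poles are simple.  The
    operator [D_mu] annihilates [varpi], so [d_mu lambda_k] is the coefficient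
    [flow] of [D_mu] taken at [lambda_k] ([is_pdc_lam]), and the Lax equation
    gives [d Psi_0k = - Omega_0(lambda_k) Psi_0k] ([lax_solution_pole]).
    Differentiating the residue of [chi] with this, all the terms at [lambda_k]
    cancel against the kernel condition, except
    [u_k (d v_k)^H Psi_0k^-1 chi^ (lambda_k)] ([dressed_form_numer_pole]).

    If the [v_k] are constant, this remainder is zero.  The reality condition
    [Omega(conj l)^H = - Gam Omega(l) Gam], a consequence of [D (chi chi^) = 0],
    carries the vanishing over to [conj lambda_k].  There remain simple poles at
    [l = i rho] and [l = - i rho], and there the residues of the two components
    of [Omega] are proportional in the way that is characteristic of a Lax form
    ([dressed_form_numer_root]); they determine the current of the dressed map
    ([new_current]).

    Conversely, if [Omega] has no pole at [lambda_k], then the remainder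
    vanishes, so [(d v_k)^H Psi_0k^-1] is in the left kernel of
    [chi^ (lambda_k)].  Since [chi^ chi = 1], this kernel is the line spanned by
    the row [v_k^H Psi_0k^-1] ([ker_unit_pfrac_residue]); therefore [d v_k] is
    parallel to [v_k], and on the connected set [U] the direction of [v_k] is
    constant ([constant_direction]).  Writing [v_k = phi_k c_k] with [c_k]
    constant, the scalar [phi_k] is absorbed in [u_k] without changing [chi]
    ([rescale_family]). *)

(** * Partial fractions with matrix residues *)

Section PartialFractions.
Context {F : fieldType} {n m : nat}.
Implicit Types (p : 'I_m -> F) (A : 'I_m -> 'M[F]_n) (l : F).

(** The rational matrix with value [1] at infinity and simple poles [p k] with
    residues [A k]. *)
Definition unit_pfrac p A l : 'M[F]_n := 1%:M + \sum_k (l - p k)^-1 *: A k.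

(** Two such matrices are inverse to each other as soon as their product has no
    residue: this is a finite set of conditions on the residues. *)
Lemma unit_pfrac_mul p A p' B l :
  (forall k j, p k != p' j) ->
  (forall k, A k *m unit_pfrac p' B (p k) = 0) ->
  (forall j, unit_pfrac p A (p' j) *m B j = 0) ->
  (forall k, l != p k) -> (forall j, l != p' j) ->
  unit_pfrac p A l *m unit_pfrac p' B l = 1%:M.
Proof.
move=> pp' AB0 BA0 lp lp'.
(* Both residue conditions express a residue through the products [A k *m B j];
   after substitution everything is a combination of these products, and the
   coefficients cancel. *)
have EA k : A k = - \sum_j (p k - p' j)^-1 *: (A k *m B j).
  apply/eqP; rewrite -addr_eq0; apply/eqP; rewrite -[RHS](AB0 k) /unit_pfrac.
  rewrite mulmxDr mulmx1 mulmx_sumr; congr (_ + _).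
  by apply: eq_bigr => j _; rewrite -scalemxAr.
have EB j : B j = - \sum_k (p' j - p k)^-1 *: (A k *m B j).
  apply/eqP; rewrite -addr_eq0; apply/eqP; rewrite -[RHS](BA0 j) /unit_pfrac.
  rewrite mulmxDl mul1mx mulmx_suml; congr (_ + _).
  by apply: eq_bigr => k _; rewrite -scalemxAl.
rewrite {1}/unit_pfrac mulmxDl mul1mx {1}/unit_pfrac -addrA -[RHS]addr0.
congr (_ + _); rewrite mulmxDr mulmx1.
have -> : (\sum_k (l - p k)^-1 *: A k) *m (\sum_j (l - p' j)^-1 *: B j) =
   \sum_k \sum_j ((l - p k)^-1 * (l - p' j)^-1) *: (A k *m B j).
  rewrite mulmx_suml; apply: eq_bigr => k _; rewrite mulmx_sumr.
  by apply: eq_bigr => j _; rewrite -scalemxAl -scalemxAr scalerA.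
have -> : \sum_j (l - p' j)^-1 *: B j =
   - \sum_k \sum_j ((l - p' j)^-1 * (p' j - p k)^-1) *: (A k *m B j).
  rewrite exchange_big -sumrN; apply: eq_bigr => j _ /=.
  rewrite {1}EB scalerN scaler_sumr; congr (- _).
  by apply: eq_bigr => k _; rewrite scalerA.
have -> : \sum_k (l - p k)^-1 *: A k =
   - \sum_k \sum_j ((l - p k)^-1 * (p k - p' j)^-1) *: (A k *m B j).
  rewrite -sumrN; apply: eq_bigr => k _ /=.
  rewrite {1}EA scalerN scaler_sumr; congr (- _).
  by apply: eq_bigr => j _; rewrite scalerA.
rewrite addrA -opprD -big_split /= addrC -sumrN -big_split big1 //=.
move=> k _; rewrite -big_split -sumrN -big_split big1 //= => j _.
rewrite -scalerDl -scaleNr -scalerDl.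
suff -> : (l - p k)^-1 * (l - p' j)^-1 -
    ((l - p' j)^-1 * (p' j - p k)^-1 + (l - p k)^-1 * (p k - p' j)^-1) = 0.
  by rewrite scale0r.
have h1 : l - p' j != 0 by rewrite subr_eq0.
have h2 : l - p k != 0 by rewrite subr_eq0.
have h3 : p k - p' j != 0 by rewrite subr_eq0.
have h4 : p' j - p k != 0 by rewrite subr_eq0 eq_sym.
by field; rewrite h1 h2 h3 h4.
Qed.

(** The numerator of [unit_pfrac p A] over the common denominator. *)
Definition pfrac_numer p A l : 'M[F]_n :=
  (\prod_k (l - p k)) *: 1%:M + \sum_k (\prod_(j | j != k) (l - p j)) *: A k.

Lemma prod_sub_ne0 p (P : pred 'I_m) l : (forall k, P k -> l != p k) ->
  \prod_(k | P k) (l - p k) != 0.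
Proof.
by move=> h; rewrite prodf_seq_neq0; apply/allP => k _; apply/implyP => /h; rewrite subr_eq0.
Qed.

Lemma prod_sub_eq0 p k : \prod_j (p k - p j) = 0.
Proof. by rewrite (bigD1 k) //= subrr mul0r. Qed.

Lemma sum_prod_sub p A l : (forall k, l != p k) ->
  \sum_k (\prod_(j | j != k) (l - p j)) *: A k =
  (\prod_k (l - p k)) *: \sum_k (l - p k)^-1 *: A k.
Proof.
move=> h; rewrite scaler_sumr; apply: eq_bigr => k _; rewrite scalerA.
by rewrite [in RHS](bigD1 k) //= mulrAC divff ?mul1r // subr_eq0 h.
Qed.

Lemma sum_prod_sub_at p A k :
  \sum_i (\prod_(j | j != i) (p k - p j)) *: A i =
  (\prod_(j | j != k) (p k - p j)) *: A k.
Proof.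
rewrite (bigD1 k) //= [X in _ + X]big1 ?addr0 // => i ik.
by rewrite (bigD1 k) 1?eq_sym //= subrr mul0r scale0r.
Qed.

Lemma pfrac_numerE p A l : (forall k, l != p k) ->
  pfrac_numer p A l = (\prod_k (l - p k)) *: unit_pfrac p A l.
Proof.
by move=> h; rewrite /pfrac_numer sum_prod_sub // /unit_pfrac -scalerDr.
Qed.

Lemma pfrac_numer_at p A k :
  pfrac_numer p A (p k) = (\prod_(j | j != k) (p k - p j)) *: A k.
Proof. by rewrite /pfrac_numer prod_sub_eq0 scale0r add0r sum_prod_sub_at. Qed.

End PartialFractions.

(** * Entire functions and principal parts *)

Section Entire.
Context {C : numClosedFieldType}.
Implicit Types f g : C -> C.

(** Complex differentiability on the whole plane. *)
Definition entire f := forall l : C, derivable f l 1.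

Lemma entire_cst (a : C) : entire (fun=> a).
Proof. by move=> l; apply: derivable_cst. Qed.
Lemma entire_id : entire (fun l => l).
Proof. by move=> l; apply: derivable_id. Qed.
Lemma entireD f g : entire f -> entire g -> entire (fun l => f l + g l).
Proof. by move=> hf hg l; apply: derivableD. Qed.
Lemma entireN f : entire f -> entire (fun l => - f l).
Proof. by move=> hf l; apply: derivableN. Qed.
Lemma entireB f g : entire f -> entire g -> entire (fun l => f l - g l).
Proof. by move=> hf hg; apply: entireD; [exact: hf|exact: entireN]. Qed.
Lemma entireM f g : entire f -> entire g -> entire (fun l => f l * g l).
Proof. by move=> hf hg l; apply: derivableM. Qed.
Lemma entireX f k : entire f -> entire (fun l => f l ^+ k).
Proof.
move=> hf; elim: k => [|k IH]; first exact: entire_cst.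
by under eq_fun do rewrite exprS; apply: entireM.
Qed.
Lemma entire_sum (I : Type) (r : seq I) (P : pred I) (f : I -> C -> C) :
  (forall i, P i -> entire (f i)) -> entire (fun l => \sum_(i <- r | P i) f i l).
Proof.
move=> hf; elim: r => [|i r IH].
  by under eq_fun do rewrite big_nil; apply: entire_cst.
under eq_fun do rewrite big_cons; case Pi: (P i); last exact: IH.
by apply: entireD; [exact: hf|exact: IH].
Qed.
Lemma entire_prod (I : Type) (r : seq I) (P : pred I) (f : I -> C -> C) :
  (forall i, P i -> entire (f i)) -> entire (fun l => \prod_(i <- r | P i) f i l).
Proof.
move=> hf; elim: r => [|i r IH].
  by under eq_fun do rewrite big_nil; apply: entire_cst.
under eq_fun do rewrite big_cons; case Pi: (P i); last exact: IH.
by apply: entireM; [exact: hf|exact: IH].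
Qed.

Lemma entire_prod_sub (I : Type) (r : seq I) (P : pred I) (p : I -> C) :
  entire (fun l => \prod_(i <- r | P i) (l - p i)).
Proof.
apply: entire_prod => i _.
by apply: entireB; [exact: entire_id|exact: entire_cst].
Qed.

Lemma entire_continuous f : entire f -> continuous f.
Proof. by move=> hf l; apply: differentiable_continuous; apply/derivable1_diffP. Qed.

Context {m n : nat}.
Implicit Types F G : C -> 'M[C]_(m, n).
(** Entrywise entire matrix functions. *)
Definition mentire {m n} (F : C -> 'M[C]_(m, n)) := forall i j, entire (fun l => F l i j).

Lemma mentire_cst (A : 'M[C]_(m, n)) : mentire (fun=> A).
Proof. by move=> i j; apply: entire_cst. Qed.
Lemma mentireD F G : mentire F -> mentire G -> mentire (fun l => F l + G l).
Proof. by move=> hF hG i j; under eq_fun do rewrite mxE; apply: entireD. Qed.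
Lemma mentireB F G : mentire F -> mentire G -> mentire (fun l => F l - G l).
Proof. by move=> hF hG i j; under eq_fun do rewrite !mxE; apply: entireB. Qed.
Lemma mentireZ f F : entire f -> mentire F -> mentire (fun l => f l *: F l).
Proof. by move=> hf hF i j; under eq_fun do rewrite mxE; apply: entireM. Qed.
Lemma mentire_sum (I : Type) (r : seq I) (F : I -> C -> 'M[C]_(m, n)) :
  (forall i, mentire (F i)) -> mentire (fun l => \sum_(i <- r) F i l).
Proof.
move=> hF i j; under eq_fun do rewrite summxE; apply: entire_sum => k _; exact: hF.
Qed.
End Entire.

Lemma mentireM (C : numClosedFieldType) m n k (F : C -> 'M[C]_(m, n))
    (G : C -> 'M[C]_(n, k)) :
  mentire F -> mentire G -> mentire (fun l => F l *m G l).
Proof.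
move=> hF hG i j; under eq_fun do rewrite mxE.
by apply: entire_sum => e _; apply: entireM; [apply: hF|apply: hG].
Qed.

Lemma near_notin (C : numClosedFieldType) (E : seq C) (l : C) : l \notin E ->
  \forall z \near l, z \notin E.
Proof.
elim: E => [|e E IH]; first by move=> _; near=> z.
rewrite inE negb_or => /andP[le lE]; near=> z; rewrite inE negb_or.
apply/andP; split; last by near: z; apply: IH.
near: z; apply: open_nbhs_nbhs; split => //.
have -> : (fun z : C => (z != e) : Prop) = ~` [set e].
  by apply/seteqP; split => z /= /eqP.
by apply: closed_openC; apply: accessible_closed_set1; apply: hausdorff_accessible; exact: norm_hausdorff.
Unshelve. all: by end_near. Qed.

Lemma dnear_notin (C : numClosedFieldType) (E : seq C) (p : C) :
  \forall z \near p^', z \notin E.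
Proof.
have : \forall z \near p, z \notin rem p (undup E).
  by apply: near_notin; rewrite mem_rem_uniq ?undup_uniq // !inE eqxx.
rewrite /prop_near1 /= => h.
have h2: \forall z \near p^', z \notin rem p (undup E) by apply: cvg_within h.
near=> z; have zp : z != p by near: z; exact: nbhs_dnbhs_neq.
have : z \notin rem p (undup E) by near: z.
by rewrite mem_rem_uniq ?undup_uniq // !inE zp mem_undup.
Unshelve. all: by end_near. Qed.

(** Continuous functions that agree off a finite set are equal. *)
Lemma continuous_eq_punctured (C : numClosedFieldType) (f g : C -> C) (E : seq C) :
  continuous f -> continuous g -> (forall l, l \notin E -> f l = g l) -> f =1 g.
Proof.
move=> cf cg fg p.
have h1 : f z @[z --> p^'] --> f p by apply: cvg_trans (cf p); apply: cvg_app; exact: cvg_within.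
have h2 : g z @[z --> p^'] --> g p by apply: cvg_trans (cg p); apply: cvg_app; exact: cvg_within.
apply: cvg_unique h1 _ => //.
apply: cvg_trans h2; apply: near_eq_cvg; near=> z; rewrite fg //.
by near: z; exact: dnear_notin.
Unshelve. all: by end_near. Qed.

Section PrincipalParts.
Context {R : realType}.
Local Notation C := R[i].
Implicit Types (f t : C -> C) (E : seq C).

Lemma principal_part_holo f p E : (forall l, l \notin E -> derivable f l 1) ->
  derivable f p 1 -> principal_part f p 0.
Proof.
move=> h hp; split.
- by rewrite coef0.
- near=> l; under eq_fun do rewrite horner0 subr0.
  by apply: h; near: l; exact: dnear_notin.
- under eq_fun do rewrite horner0 subr0.
  apply/cvg_ex; exists (f p).
  apply: cvg_trans (_ : f @ p --> f p); first by apply: cvg_app; exact: cvg_within.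
  by apply: differentiable_continuous; apply/derivable1_diffP.
Unshelve. all: by end_near. Qed.

(** The principal part [c / (l - p)], as a polynomial in [(l - p)^-1]. *)
Definition simple_pole (c : C) : {poly C} := c *: 'X.

(** The regular part of [F l / (l - p)] is the difference quotient of [F] at [p],
    which converges to the derivative of [F]. *)
Lemma principal_part_simple f F p E : p \in E ->
  (forall l, l \notin E -> f l = F l / (l - p)) ->
  (forall l, l \notin E -> derivable F l 1) -> derivable F p 1 ->
  principal_part f p (simple_pole (F p)).
Proof.
move=> pE hf hF hp.
have gE l : l \notin E -> f l - (simple_pole (F p)).[(l - p)^-1] = (F l - F p) / (l - p).
  by move=> lE; rewrite hf // /simple_pole hornerZ hornerX mulrBl.
split.
- by rewrite /simple_pole coefZ coefX mulr0.
- near=> l; have lE : l \notin E by near: l; exact: dnear_notin.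
  apply: near_eq_derivable (_ : {near l, (fun l => (F l - F p) / (l - p)) =1 _}) _.
    near=> z; rewrite /= gE //; near: z; exact: near_notin.
  apply: derivableM; first by apply: derivableB; [exact: hF|exact: derivable_cst].
  apply: derivableV; last by apply: derivableB; [exact: derivable_id|exact: derivable_cst].
  by rewrite subr_eq0; apply: contraNneq lE => ->.
- apply/cvg_ex; exists ('D_1 F p).
  apply: cvg_trans (_ : (F l - F p) / (l - p) @[l --> p^'] --> _).
    by apply: near_eq_cvg; near=> l; rewrite gE //; near: l; exact: dnear_notin.
  apply/cvgrPdist_lt => e e0; have := hp; rewrite /derivable => /cvg_ex [d hd].
  have -> : 'D_1 F p = d by rewrite /derive (cvg_lim _ hd).
  move/cvgrPdist_lt: hd => /(_ e e0) [r /= r0 hr].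
  exists r => //= z; rewrite /= distrC => zr zp.
  have := hr (z - p); rewrite /= sub0r normrN subr_eq0 => /(_ zr zp).
  by rewrite [(z - p) *: 1]mulr1 subrK mulrC.
Unshelve. all: by end_near. Qed.

Lemma derivable_quot_prod (t : C -> C) E l : entire t -> l \notin E ->
  derivable (fun z => t z / \prod_(e <- E) (z - e)) l 1.
Proof.
move=> ht lE; apply: derivableM; first exact: ht.
apply: derivableV.
  by rewrite prodf_seq_neq0; apply/allP => e eE; rewrite subr_eq0; apply: contraNneq lE => ->.
apply: entire_prod => e _; exact: entireB (@entire_id _) (@entire_cst _ _).
Qed.

Lemma principal_part_quot_prod f t E p : uniq E -> entire t ->
  (forall l, l \notin E -> f l = t l / \prod_(e <- E) (l - e)) ->
  principal_part f p
    (if p \in E then simple_pole (t p / \prod_(e <- rem p E) (p - e)) else 0).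
Proof.
move=> uE ht hf.
have hE l : l \notin E -> derivable f l 1.
  move=> lE; apply: near_eq_derivable (derivable_quot_prod ht lE).
  by near=> z; rewrite hf //; near: z; exact: near_notin.
case: ifPn => pE; last by apply: (@principal_part_holo _ _ E) => //; exact: hE.
set F := fun l => t l / \prod_(e <- rem p E) (l - e).
apply: (@principal_part_simple f F p E pE).
- by move=> l lE; rewrite hf // (big_rem p) //= invfM mulrCA mulrC.
- move=> l lE; apply: derivable_quot_prod => //.
  by apply: contraNN lE; exact: mem_rem.
- apply: derivable_quot_prod => //.
  by rewrite mem_rem_uniq // !inE eqxx.
Unshelve. all: by end_near. Qed.

(** Two functions with at most simple poles, all in [E], have the same principal
    parts as soon as their numerators over the common denominator agree on [E]. *)
Lemma same_principal_parts f1 f2 t1 t2 E p : uniq E -> entire t1 -> entire t2 ->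
  (forall l, l \notin E -> f1 l = t1 l / \prod_(e <- E) (l - e)) ->
  (forall l, l \notin E -> f2 l = t2 l / \prod_(e <- E) (l - e)) ->
  {in E, t1 =1 t2} ->
  exists P, principal_part f1 p P /\ principal_part f2 p P.
Proof.
move=> uE h1 h2 e1 e2 e12.
have P1 := principal_part_quot_prod p uE h1 e1.
have P2 := principal_part_quot_prod p uE h2 e2.
eexists; split; first exact: P1.
by move: P2; case: ifP => [pE|_]; [rewrite -e12|].
Qed.
End PrincipalParts.

Section Conjugation.
Context {C : numClosedFieldType}.

Lemma conjC_continuous : continuous (fun z : C => z^*%R).
Proof.
move=> z; apply: (iffRL (@cvgrPdist_lt C C C (nbhs z) _ _ _)) => e e0.
by exists e => //= y; rewrite /= -rmorphB norm_conjC.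
Qed.

(** A symmetry under conjugation, known off a finite set, transports zeros of an
    entire function. *)
Lemma entire_conj_root n (Gam : 'M[C]_n) (T : C -> 'M[C]_n) (E : seq C) (p : C) :
  Gam *m Gam = 1%:M -> mentire T ->
  (forall l, l \notin E -> Gam *m T l *m Gam = - (T l^*%R) ^t*) ->
  T p = 0 -> T p^*%R = 0.
Proof.
move=> GG hT hs Tp.
suff h : Gam *m T p^*%R *m Gam = 0.
  have : Gam *m (Gam *m T p^*%R *m Gam) *m Gam = 0 by rewrite h mulmx0 mul0mx.
  by rewrite !mulmxA GG mul1mx -mulmxA GG mulmx1.
apply/matrixP => i j; rewrite [RHS]mxE.
have := @continuous_eq_punctured C (fun l => (Gam *m T l *m Gam) i j)
  (fun l => - (T l^*%R j i)^*%R) E.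
move=> ->; last by move=> l /hs ->; rewrite !mxE.
- by rewrite conjCK Tp mxE rmorph0 oppr0.
- apply: entire_continuous.
  have h := mentireM (mentireM (@mentire_cst _ _ _ Gam) hT) (@mentire_cst _ _ _ Gam).
  exact: (h i j).
- move=> l.
  apply: (continuous_comp (f := fun l => (T l^*%R j i)^*%R) (g := fun z : C => - z)); last exact: opp_continuous.
  apply: (continuous_comp (f := fun l => T l^*%R j i) (g := fun z => z^*%R)); last exact: conjC_continuous.
  apply: (continuous_comp (f := fun l : C => l^*%R) (g := fun z => T z j i)); first exact: conjC_continuous.
  exact: entire_continuous.
Qed.
End Conjugation.

(** * The dressing transformation in the variable [l] *)

Section Model.
Context {C : numClosedFieldType} {n m : nat}.
Variables (p p' : 'I_m -> C) (A B Q : 'I_m -> 'M[C]_n).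
Variables (s : C -> C) (N0 : C -> 'M[C]_n) (g : 'I_m -> C -> C).

(** The dressing formula at a fixed point of the half-plane and for a fixed
    component.  The poles [p] and residues [A] are those of [chi], and [p'] and
    [B] those of its inverse; [Q k] is the derivative of [A k], the Lax form is
    [N0 l / s l], and [g k l / s l] is the divided difference at [p k] and [l] of
    the coefficient of the [l]-derivative in [D].  Then [dpfrac] is [D chi],
    [dressed] is the dressed form and [dressed_numer] its numerator over the
    common denominator. *)
Definition dpfrac (l : C) : 'M[C]_n :=
  \sum_k (l - p k)^-1 *: (Q k - (g k l / s l) *: A k).

Definition dressed (l : C) : 'M[C]_n :=
  (unit_pfrac p A l *m ((s l)^-1 *: N0 l) - dpfrac l) *m unit_pfrac p' B l.

Definition dressed_numer (l : C) : 'M[C]_n :=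
  (pfrac_numer p A l *m N0 l
   - \sum_k (\prod_(j | j != k) (l - p j)) *: (s l *: Q k - g k l *: A k))
  *m pfrac_numer p' B l.

Lemma dressed_numerE l : s l != 0 -> (forall k, l != p k) -> (forall k, l != p' k) ->
  dressed_numer l =
  (\prod_k (l - p k) * \prod_k (l - p' k) * s l) *: dressed l.
Proof.
move=> sl lp lp'; rewrite /dressed_numer /dressed !pfrac_numerE //.
rewrite (sum_prod_sub (fun k => s l *: Q k - g k l *: A k)) //.
have -> : unit_pfrac p A l *m ((s l)^-1 *: N0 l) - dpfrac l =
  (s l)^-1 *: (unit_pfrac p A l *m N0 l
     - \sum_k (l - p k)^-1 *: (s l *: Q k - g k l *: A k)).
  rewrite scalerBr scalemxAr; congr (_ - _); rewrite /dpfrac scaler_sumr.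
  apply: eq_bigr => k _; rewrite [RHS]scalerA [X in _ = X *: _]mulrC -[RHS]scalerA; congr (_ *: _).
  by rewrite scalerBr !scalerA mulVf // scale1r [(s l)^-1 * _]mulrC.
rewrite -scalemxAl -scalerBr -!scalemxAl -scalemxAr !scalerA.
by rewrite -[_ * s l / s l]mulrA divff // mulr1.
Qed.

Lemma dressed_numer_at k : s (p k) != 0 -> (forall j, p k != p' j) ->
  dressed_numer (p k) =
  (\prod_(j | j != k) (p k - p j) * \prod_j (p k - p' j) * s (p k)) *:
   ((A k *m ((s (p k))^-1 *: N0 (p k)) - Q k + (g k (p k) / s (p k)) *: A k)
    *m unit_pfrac p' B (p k)).
Proof.
move=> sp pp'; rewrite /dressed_numer pfrac_numer_at.
rewrite (sum_prod_sub_at p (fun i => s (p k) *: Q i - g i (p k) *: A i)).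
rewrite pfrac_numerE //.
have -> : A k *m ((s (p k))^-1 *: N0 (p k)) - Q k + (g k (p k) / s (p k)) *: A k =
  (s (p k))^-1 *: (A k *m N0 (p k) - (s (p k) *: Q k - g k (p k) *: A k)).
  rewrite [RHS]scalerBr [X in _ = _ - X]scalerBr opprB !scalerA mulVf // scale1r.
  by rewrite scalemxAr [_^-1 * g k _]mulrC addrA [RHS]addrAC.
rewrite -scalemxAl -scalerBr -!scalemxAl -scalemxAr !scalerA.
by rewrite -[_ * s _ / s _]mulrA divff // mulr1.
Qed.

Lemma mentire_pfrac_numer (q : 'I_m -> C) (D : 'I_m -> 'M[C]_n) :
  mentire (pfrac_numer q D).
Proof.
have e1 (j : 'I_m) : entire (fun l => l - q j).
  exact: entireB (@entire_id _) (@entire_cst _ _).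
apply: mentireD.
  by apply: mentireZ; [apply: entire_prod => j _|apply: mentire_cst].
apply: mentire_sum => j.
by apply: mentireZ; [apply: entire_prod => i _|apply: mentire_cst].
Qed.

Lemma mentire_dressed_numer : entire s -> mentire N0 -> (forall k, entire (g k)) ->
  mentire dressed_numer.
Proof.
move=> es eN eg; apply: mentireM; last exact: mentire_pfrac_numer.
apply: mentireB; first by apply: mentireM; [exact: mentire_pfrac_numer|].
apply: mentire_sum => j; apply: mentireZ.
  apply: entire_prod => i _; exact: entireB (@entire_id _) (@entire_cst _ _).
by apply: mentireB; (apply: mentireZ; [|exact: mentire_cst]); [exact: es|exact: eg].
Qed.

(** The left kernel of a factor of the inverse at a simple pole [p k] of
    [unit_pfrac p A] lies in the row space of the residue. *)
Lemma ker_unit_pfrac_residue k (y : 'rV[C]_n) :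
  injective p -> (forall i j, p i != p' j) ->
  (forall l, (forall k, l != p k) -> (forall k, l != p' k) ->
     unit_pfrac p' B l *m unit_pfrac p A l = 1%:M) ->
  y *m unit_pfrac p' B (p k) = 0 -> exists z : 'rV[C]_n, y = z *m A k.
Proof.
move=> ip pp' inv1 y0.
pose qk l := \prod_(j | j != k) (l - p j).
pose q' l := \prod_j (l - p' j).
pose D l := \sum_j ((p' j - p k)^-1 * \prod_(i | i != j) (l - p' i)) *: (y *m B j).
have yB l : (forall j, l != p' j) ->
    q' l *: (y *m unit_pfrac p' B l) = (l - p k) *: D l.
  move=> lp'; rewrite -[y *m _ in LHS]subr0 -y0 -mulmxBr /unit_pfrac opprD addrACA subrr add0r.
  rewrite -sumrB mulmx_sumr !scaler_sumr; apply: eq_bigr => j _.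
  rewrite -scalerBl -scalemxAr !scalerA; congr (_ *: _).
  rewrite /q' (bigD1 j) //=.
  have h1 : l - p' j != 0 by rewrite subr_eq0.
  have h2 : p k - p' j != 0 by rewrite subr_eq0.
  have h3 : p' j - p k != 0 by rewrite subr_eq0 eq_sym.
  by field; rewrite h1 h2 h3.
(* After multiplication by the denominators, [y = y (chi^-1 chi)] extends by
   continuity to the pole, where only the residue [A k] survives. *)
have key : forall l, (q' l * qk l) *: y = D l *m pfrac_numer p A l.
  move=> l; apply/matrixP => a b.
  pose E := codom p ++ codom p'.
  have eq1 (j : 'I_m) (q : 'I_m -> C) : entire (fun l => l - q j).
    exact: entireB (@entire_id _) (@entire_cst _ _).
  apply: (@continuous_eq_punctured C (fun l => ((q' l * qk l) *: y) a b)
    (fun l => (D l *m pfrac_numer p A l) a b) E).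
  - apply: entire_continuous.
    apply: (@mentireZ C 1 n (fun l => q' l * qk l) (fun=> y)); last exact: mentire_cst.
    by apply: entireM; apply: entire_prod => j _; exact: eq1.
  - apply: entire_continuous.
    apply: (mentireM (F := D)); last exact: mentire_pfrac_numer.
    apply: mentire_sum => j; apply: mentireZ; last exact: mentire_cst.
    by apply: entireM; [apply: entire_cst|apply: entire_prod => i _; exact: eq1].
  move=> {}l; rewrite mem_cat negb_or => /andP[/codomP lE /codomP lE'].
  have lp i : l != p i by apply/eqP => h; apply: lE; exists i.
  have lp' i : l != p' i by apply/eqP => h; apply: lE'; exists i.
  congr (fun_of_matrix _ a b).
  rewrite pfrac_numerE // (bigD1 k) //= -/(qk l) -scalemxAr scalemxAl -scalerA.
  rewrite [X in X *m _](_ : _ = (qk l * q' l) *: (y *m unit_pfrac p' B l)).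
    by rewrite -scalemxAl -mulmxA inv1 // mulmx1 scalerA mulrC.
  by rewrite -[RHS]scalerA yB // scalerA mulrC.
have := key (p k); rewrite pfrac_numer_at -/(qk _).
have q0 : qk (p k) != 0.
  by apply: prod_sub_ne0 => j jk; apply: contra_neq jk => /ip ->.
have q'0 : q' (p k) != 0 by apply: prod_sub_ne0.
move=> h; exists ((q' (p k))^-1 *: D (p k)).
have : (q' (p k) * qk (p k))^-1 *: ((q' (p k) * qk (p k)) *: y) = y.
  by rewrite scalerA mulVf ?scale1r // mulf_neq0.
move=> <-; rewrite h -scalemxAr -scalemxAl scalerA invfM -mulrA mulVf // mulr1.
by [].
Qed.
End Model.

(** * Complex derivatives of matrix functions *)

Section ComplexDerivative.
Context {C : numClosedFieldType}.

(** [D] is the complex derivative of [F] at [l], entry by entry. *)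
Definition is_mderive {m n} (F : C -> 'M[C]_(m, n)) (l : C) (D : 'M[C]_(m, n)) :=
  forall i j, is_derive l 1 (fun z => F z i j) (D i j).

Lemma is_derive_bigsum (I : Type) (r : seq I) (f : I -> C -> C) (l : C) (d : I -> C) :
  (forall i, is_derive l 1 (f i) (d i)) ->
  is_derive l 1 (fun z => \sum_(i <- r) f i z) (\sum_(i <- r) d i).
Proof.
move=> h; elim: r => [|i r IH].
  by under eq_fun do rewrite big_nil; rewrite big_nil; apply: is_derive_cst.
under eq_fun do rewrite big_cons; rewrite big_cons; exact: is_deriveD.
Qed.

Lemma is_mderiveM m n p (F : C -> 'M[C]_(m, n)) (G : C -> 'M[C]_(n, p)) l D E :
  is_mderive F l D -> is_mderive G l E ->
  is_mderive (fun z => F z *m G z) l (D *m G l + F l *m E).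
Proof.
move=> hF hG i j; under eq_fun do rewrite mxE.
rewrite !mxE -big_split; apply: is_derive_bigsum => k.
apply: is_derive_eq (is_deriveM (hF i k) (hG k j)) _.
by rewrite /GRing.scale /= addrC; congr (_ + _); rewrite mulrC.
Qed.

Lemma is_mderive_near_cst m n (F : C -> 'M[C]_(m, n)) (A : 'M[C]_(m, n)) l D :
  (\forall z \near l, F z = A) -> is_mderive F l D -> D = 0.
Proof.
move=> FA hF; apply/matrixP => i j; rewrite mxE.
have [_ <-] := hF i j.
rewrite (@near_eq_derive _ _ _ _ (fun=> A i j)); first exact: derive_cst.
by apply: filterS FA => z ->.
Qed.

Lemma is_mderive_unit_pfrac n m (p : 'I_m -> C) (A : 'I_m -> 'M[C]_n) l :
  (forall k, l != p k) ->
  is_mderive (unit_pfrac p A) l (\sum_k (- (l - p k) ^- 2) *: A k).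
Proof.
move=> lp i j.
have E : (fun z => unit_pfrac p A z i j) =
   (fun z => (1%:M : 'M[C]_n) i j + \sum_k (z - p k)^-1 * A k i j).
  apply/funext => z; rewrite /unit_pfrac mxE summxE; congr (_ + _).
  by apply: eq_bigr => k _; rewrite mxE.
rewrite E summxE.
have h k : is_derive l 1 (fun z => (z - p k)^-1 * A k i j)
    (((- (l - p k) ^- 2) *: A k) i j).
  have n0 : l - p k != 0 by rewrite subr_eq0.
  have h1 : is_derive l 1 (fun z => z - p k) 1.
    have := is_deriveB (is_derive_id l 1) (is_derive_cst (p k) l (1 : C)).
    by rewrite subr0.
  have h2 : is_derive l 1 (fun z => (z - p k)^-1) (- (l - p k) ^- 2).
    split; first by apply: derivableV => //; case: h1.
    by rewrite deriveV; [rewrite derive_val [_ *: _]mulr1|by []|by case: h1].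
  have h3 := is_deriveM h2 (is_derive_cst (A k i j) l (1 : C)).
  apply: is_derive_eq h3 _.
  by rewrite mxE scaler0 add0r [_ *: _]mulrC.
have := is_deriveD (is_derive_cst ((1%:M : 'M[C]_n) i j) l (1 : C)) (is_derive_bigsum (index_enum 'I_m) h).
by rewrite add0r.
Qed.
End ComplexDerivative.

(** * Real and imaginary parts *)

Section ComplexParts.
Context {R : realType}.
Local Notation C := R[i].
Implicit Types z w : C.

Lemma cReD z w : complex.Re (z + w) = complex.Re z + complex.Re w.
Proof. by case: z; case: w. Qed.
Lemma cImD z w : complex.Im (z + w) = complex.Im z + complex.Im w.
Proof. by case: z; case: w. Qed.
Lemma cReN z : complex.Re (- z) = - complex.Re z. Proof. by case: z. Qed.
Lemma cImN z : complex.Im (- z) = - complex.Im z. Proof. by case: z. Qed.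
Lemma cReM z w : complex.Re (z * w) =
  complex.Re z * complex.Re w - complex.Im z * complex.Im w.
Proof. by case: z; case: w. Qed.
Lemma cImM z w : complex.Im (z * w) =
  complex.Re z * complex.Im w + complex.Im z * complex.Re w.
Proof. by case: z; case: w. Qed.
Lemma cRe_conj z : complex.Re z^*%R = complex.Re z. Proof. by case: z. Qed.
Lemma cIm_conj z : complex.Im z^*%R = - complex.Im z. Proof. by case: z. Qed.
Lemma cReV z : complex.Re z^-1 =
  complex.Re z * (complex.Re z ^+ 2 + complex.Im z ^+ 2)^-1.
Proof. by case: z. Qed.
Lemma cImV z : complex.Im z^-1 =
  - (complex.Im z * (complex.Re z ^+ 2 + complex.Im z ^+ 2)^-1).
Proof. by case: z. Qed.

Lemma complex_eqP z w : complex.Re z = complex.Re w ->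
  complex.Im z = complex.Im w -> z = w.
Proof. by case: z => ? ?; case: w => ? ? /= -> ->. Qed.

Lemma normsq_ne0 z : z != 0 -> complex.Re z ^+ 2 + complex.Im z ^+ 2 != 0.
Proof.
case: z => a b; rewrite eq_complex /= negb_and => h.
by rewrite paddr_eq0 ?sqr_ge0 // !sqrf_eq0 negb_and.
Qed.

Lemma norm_Re_le z : `|complex.Re z|%:C <= `|z|.
Proof. exact: normc_ge_Re. Qed.
Lemma norm_Im_le z : `|complex.Im z|%:C <= `|z|.
Proof.
have := normc_ge_Re (z * 'i%C); rewrite ReiNIm normrN normrM.
by rewrite (_ : `|'i%C| = 1) ?mulr1 // normc_def /= expr0n expr1n add0r sqrtr1.
Qed.

Lemma norm_real_complex (r : R) : `|r%:C : C| = `|r|%:C.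
Proof. by rewrite normc_def /= expr0n addr0 sqrtr_sqr. Qed.

Lemma gt0_complexE (e : C) : 0 < e -> 0 < complex.Re e /\ e = (complex.Re e)%:C.
Proof. by case: e => a b; rewrite ltcE /= => /andP[/eqP -> ->]. Qed.

Lemma Re_continuous : continuous (@complex.Re R : C -> R).
Proof.
move=> z; apply: (iffRL (@cvgrPdist_lt R _ C (nbhs z) _ _ _)) => e e0.
exists e%:C; first by rewrite /= ltcR.
move=> y /= h; rewrite -cReN -cReD -ltcR; apply: le_lt_trans h; exact: norm_Re_le.
Qed.

Lemma Im_continuous : continuous (@complex.Im R : C -> R).
Proof.
move=> z; apply: (iffRL (@cvgrPdist_lt R _ C (nbhs z) _ _ _)) => e e0.
exists e%:C; first by rewrite /= ltcR.
move=> y /= h; rewrite -cImN -cImD -ltcR; apply: le_lt_trans h; exact: norm_Im_le.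
Qed.

Lemma real_complex_continuous : continuous (fun r : R => r%:C : C).
Proof.
move=> z; apply: (iffRL (@cvgrPdist_lt C C R (nbhs z) _ _ _)) => e /gt0_complexE[e0 ->].
exists (complex.Re e) => //= y /= h; rewrite -rmorphB norm_real_complex.
by rewrite ltcR.
Qed.
End ComplexParts.

(** * Partial derivatives of complex functions on the half-plane *)

Section PartialDerivatives.
Context {R : realType}.
Local Notation C := R[i].
Implicit Types (f g : R * R -> C) (x : R * R) (mu : axis).

(** [f] has at [x] the partial derivative [d] along the axis [mu]; only
    derivability along this axis is required. *)
Definition is_pdc mu f x (d : C) :=
  is_derive x (dir mu) (fun y => complex.Re (f y)) (complex.Re d) /\
  is_derive x (dir mu) (fun y => complex.Im (f y)) (complex.Im d).

Lemma is_pdcE mu f x d : is_pdc mu f x d -> pdc mu f x = d.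
Proof. by case=> h1 h2; apply: complex_eqP; rewrite /= derive_val. Qed.

Lemma rdiff_is_pdc mu f x : rdiff f x -> is_pdc mu f x (pdc mu f x).
Proof. by case=> h1 h2; split; apply: derivableP; exact: diff_derivable. Qed.

Lemma near_is_pdc mu f g x d : (\forall y \near x, f y = g y) ->
  is_pdc mu f x d -> is_pdc mu g x d.
Proof.
move=> fg [h1 h2]; split.
  by apply: near_eq_is_derive h1; apply: filterS fg => y ->.
by apply: near_eq_is_derive h2; apply: filterS fg => y ->.
Qed.

Lemma is_pdc_cst mu (a : C) x : is_pdc mu (fun=> a) x 0.
Proof. by split; apply: is_derive_cst. Qed.

Lemma is_pdcD mu f g x d e : is_pdc mu f x d -> is_pdc mu g x e ->
  is_pdc mu (fun y => f y + g y) x (d + e).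
Proof.
move=> [h1 h2] [k1 k2]; split.
  under eq_fun do rewrite cReD; rewrite cReD; exact: is_deriveD.
under eq_fun do rewrite cImD; rewrite cImD; exact: is_deriveD.
Qed.

Lemma is_pdcN mu f x d : is_pdc mu f x d -> is_pdc mu (fun y => - f y) x (- d).
Proof.
move=> [h1 h2]; split.
  under eq_fun do rewrite cReN; rewrite cReN; exact: is_deriveN.
under eq_fun do rewrite cImN; rewrite cImN; exact: is_deriveN.
Qed.

Lemma is_pdcM mu f g x d e : is_pdc mu f x d -> is_pdc mu g x e ->
  is_pdc mu (fun y => f y * g y) x (d * g x + f x * e).
Proof.
move=> [h1 h2] [k1 k2]; split.
  under eq_fun do rewrite cReM.
  have := is_deriveB (is_deriveM h1 k1) (is_deriveM h2 k2).
  move/is_derive_eq; apply; rewrite cReD !cReM /GRing.scale /=; ring.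
under eq_fun do rewrite cImM.
have := is_deriveD (is_deriveM h1 k2) (is_deriveM h2 k1).
move/is_derive_eq; apply; rewrite cImD !cImM /GRing.scale /=; ring.
Qed.

Lemma is_pdc_conj mu f x d : is_pdc mu f x d ->
  is_pdc mu (fun y => (f y)^*%R) x d^*%R.
Proof.
move=> [h1 h2]; split.
  by under eq_fun do rewrite cRe_conj; rewrite cRe_conj.
under eq_fun do rewrite cIm_conj; rewrite cIm_conj; exact: is_deriveN.
Qed.

Lemma is_pdcV mu f x d : f x != 0 -> is_pdc mu f x d ->
  is_pdc mu (fun y => (f y)^-1) x (- (f x)^-1 * d * (f x)^-1).
Proof.
move=> f0 [h1 h2]; have n0 := normsq_ne0 f0.
pose N y := complex.Re (f y) ^+ 2 + complex.Im (f y) ^+ 2.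
pose dN := 2 * complex.Re (f x) * complex.Re d + 2 * complex.Im (f x) * complex.Im d.
have hN : is_derive x (dir mu) N dN.
  have := is_deriveD (is_deriveM h1 h1) (is_deriveM h2 h2).
  move/is_derive_eq; apply; rewrite /dN /GRing.scale /=; ring.
have hV : is_derive x (dir mu) (fun y => (N y)^-1) (- (N x) ^- 2 * dN).
  have dd : derivable N x (dir mu) by [].
  split; first by apply: derivableV.
  by rewrite deriveV // derive_val.
split.
  under eq_fun do rewrite cReV.
  have := is_deriveM h1 hV; move/is_derive_eq; apply.
  rewrite !(cReM, cImM, cReN, cImN, cReV, cImV) -/(N x) /GRing.scale /= /dN.
  rewrite -/(N x) in n0; move: n0; rewrite /N; set a := complex.Re (f x); set b := complex.Im (f x).
  by move=> n0; field.
under eq_fun do rewrite cImV.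
have := is_deriveN (is_deriveM h2 hV); move/is_derive_eq; apply.
rewrite !(cReM, cImM, cReN, cImN, cReV, cImV) -/(N x) /GRing.scale /= /dN.
rewrite -/(N x) in n0; move: n0; rewrite /N; set a := complex.Re (f x); set b := complex.Im (f x).
by move=> n0; field.
Qed.

Lemma is_pdc_sum mu (I : Type) (r : seq I) (P : pred I) (f : I -> R * R -> C) x (d : I -> C) :
  (forall i, P i -> is_pdc mu (f i) x (d i)) ->
  is_pdc mu (fun y => \sum_(i <- r | P i) f i y) x (\sum_(i <- r | P i) d i).
Proof.
move=> h; elim: r => [|i r IH].
  by under eq_fun do rewrite big_nil; rewrite big_nil; apply: is_pdc_cst.
under eq_fun do rewrite big_cons; rewrite big_cons; case: (boolP (P i)) => // Pi.
by apply: is_pdcD => //; apply: h.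
Qed.

(** Existence of a partial derivative along [mu]. *)
Definition pdcable mu f x := exists d, is_pdc mu f x d.

Lemma pdcable_prod mu (I : Type) (r : seq I) (f : I -> R * R -> C) x :
  (forall i, pdcable mu (f i) x) ->
  pdcable mu (fun y => \prod_(i <- r) f i y) x.
Proof.
move=> h; elim: r => [|i r [d IH]].
  by under eq_fun do rewrite big_nil; exists 0; apply: is_pdc_cst.
have [e he] := h i; under eq_fun do rewrite big_cons.
by exists (e * \prod_(j <- r) f j x + f i x * d); apply: is_pdcM.
Qed.

(** Derivative from a factorization of the increments. *)
Lemma is_pdc_slope mu f x d (a : R -> C) : a h @[h --> 0^'] --> d ->
  (\forall h \near 0^', f (h *: dir mu + x) - f x = h%:C * a h) ->
  is_pdc mu f x d.
Proof.
move=> ad fa.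
have H (P : C -> R) : continuous P -> (forall z w, P (z - w) = P z - P w) ->
    (forall (h : R) z, P (h%:C * z) = h * P z) ->
    is_derive x (dir mu) (fun y => P (f y)) (P d).
  move=> cP PB PZ.
  have : h^-1 *: (P (f (h *: dir mu + x)) - P (f x)) @[h --> 0^'] --> P d.
    have hh := cvg_comp _ _ ad (cP d); apply: cvg_trans hh.
    apply: near_eq_cvg; near=> h.
    have h0 : h != 0 by near: h; exact: nbhs_dnbhs_neq.
    rewrite -PB (_ : f _ - f x = h%:C * a h); last by near: h.
    by rewrite PZ /GRing.scale /= mulKf.
  move=> hP; split; first by apply/cvg_ex; exists (P d).
  exact: cvg_lim.
split; apply: H.
- exact: Re_continuous.
- by move=> z w; rewrite cReD cReN.
- by move=> h z; rewrite cReM /= mul0r subr0.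
- exact: Im_continuous.
- by move=> z w; rewrite cImD cImN.
- by move=> h z; rewrite cImM /= mul0r addr0.
Unshelve. all: by end_near. Qed.

End PartialDerivatives.

(** * Partial derivatives of matrix functions *)

Section MatrixPartial.
Context {R : realType}.
Local Notation C := R[i].
Implicit Types (x : R * R) (mu : axis).

(** [D] is the partial derivative of [F] at [x] along [mu], entry by entry. *)
Definition is_mpd {m n} mu (F : R * R -> 'M[C]_(m, n)) x (D : 'M[C]_(m, n)) :=
  forall i j, is_pdc mu (fun y => F y i j) x (D i j).

Lemma is_mpdE m n mu (F : R * R -> 'M[C]_(m, n)) x D : is_mpd mu F x D -> pd mu F x = D.
Proof. by move=> h; apply/matrixP => i j; rewrite mxE; exact: is_pdcE. Qed.

Lemma mdiff_is_mpd m n mu (F : R * R -> 'M[C]_(m, n)) x : mdiff F x -> is_mpd mu F x (pd mu F x).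
Proof. by move=> h i j; rewrite mxE; apply: rdiff_is_pdc. Qed.

Lemma near_is_mpd m n mu (F G : R * R -> 'M[C]_(m, n)) x D : (\forall y \near x, F y = G y) ->
  is_mpd mu F x D -> is_mpd mu G x D.
Proof. by move=> fg h i j; apply: near_is_pdc (h i j); apply: filterS fg => y ->. Qed.

Lemma is_mpd_cst m n mu (A : 'M[C]_(m, n)) x : is_mpd mu (fun=> A) x 0.
Proof. by move=> i j; rewrite mxE; apply: is_pdc_cst. Qed.

Lemma is_mpdD m n mu (F G : R * R -> 'M[C]_(m, n)) x D E :
  is_mpd mu F x D -> is_mpd mu G x E -> is_mpd mu (fun y => F y + G y) x (D + E).
Proof. by move=> hF hG i j; rewrite mxE; under eq_fun do rewrite mxE; apply: is_pdcD. Qed.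

Lemma is_mpdM m n p mu (F : R * R -> 'M[C]_(m, n)) (G : R * R -> 'M[C]_(n, p)) x D E :
  is_mpd mu F x D -> is_mpd mu G x E ->
  is_mpd mu (fun y => F y *m G y) x (D *m G x + F x *m E).
Proof.
move=> hF hG i j; under eq_fun do rewrite mxE.
rewrite !mxE -big_split; apply: is_pdc_sum => k _; exact: is_pdcM.
Qed.

Lemma is_mpd_mul_cst m n p r mu (G : 'M[C]_(m, n)) (F : R * R -> 'M[C]_(n, p))
    (K : 'M[C]_(p, r)) x D :
  is_mpd mu F x D -> is_mpd mu (fun y => G *m F y *m K) x (G *m D *m K).
Proof.
move=> hF; have h := is_mpdM (is_mpdM (is_mpd_cst mu G x) hF) (is_mpd_cst mu K x).
suff <- : (0 *m F x + G *m D) *m K + G *m F x *m 0 = G *m D *m K by [].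
by rewrite mul0mx add0r mulmx0 addr0.
Qed.

Lemma is_mpdZ m n mu (f : R * R -> C) (F : R * R -> 'M[C]_(m, n)) x d D :
  is_pdc mu f x d -> is_mpd mu F x D ->
  is_mpd mu (fun y => f y *: F y) x (d *: F x + f x *: D).
Proof. by move=> hf hF i j; rewrite !mxE; under eq_fun do rewrite mxE; apply: is_pdcM. Qed.

Lemma is_mpd_sum m n mu (I : Type) (r : seq I) (F : I -> R * R -> 'M[C]_(m, n)) x D :
  (forall i, is_mpd mu (F i) x (D i)) ->
  is_mpd mu (fun y => \sum_(i <- r) F i y) x (\sum_(i <- r) D i).
Proof.
move=> h i j; under eq_fun do rewrite summxE; rewrite summxE.
by apply: is_pdc_sum => k _; exact: h.
Qed.

Lemma is_mpd_adj m n mu (F : R * R -> 'M[C]_(m, n)) x D :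
  is_mpd mu F x D -> is_mpd mu (fun y => (F y) ^t*) x (D ^t*).
Proof. by move=> h i j; rewrite !mxE; under eq_fun do rewrite !mxE; apply: is_pdc_conj. Qed.

Lemma pdcable_det n mu (F : R * R -> 'M[C]_n) x :
  (forall i j, pdcable mu (fun y => F y i j) x) -> pdcable mu (fun y => \det (F y)) x.
Proof.
move=> h.
have H (s : 'S_n) : exists d,
    is_pdc mu (fun y => (-1) ^+ s * \prod_i F y i (s i)) x d.
  have [d hd] := @pdcable_prod _ mu _ (index_enum 'I_n) (fun i y => F y i (s i)) x (fun i => h i (s i)).
  eexists; apply: is_pdcM; [exact: is_pdc_cst|exact: hd].
have [d hd] := choice H.
by exists (\sum_s d s); apply: is_pdc_sum => s _; exact: hd.
Qed.

(** The derivative of the inverse, for maps with invertible values near [x]. *)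
Lemma is_mpd_inv n mu (F : R * R -> 'M[C]_n) x D :
  (\forall y \near x, F y \in unitmx) -> is_mpd mu F x D ->
  is_mpd mu (fun y => invmx (F y)) x (- (invmx (F x) *m D *m invmx (F x))).
Proof.
move=> Fu hF; have Fx := nbhs_singleton Fu.
have able i j : pdcable mu (fun y => F y i j) x by exists (D i j).
(* Derivability comes from Cramer's formula, the value from [F F^-1 = 1]. *)
have [E hE] : exists E, is_mpd mu (fun y => invmx (F y)) x E.
  have H (a : 'I_n * 'I_n) : exists d, is_pdc mu (fun y => invmx (F y) a.1 a.2) x d.
    have [d hd] := pdcable_det able.
    have [c hc] : pdcable mu (fun y => \det (row' a.2 (col' a.1 (F y)))) x.
      apply: pdcable_det => i j; under eq_fun do rewrite !mxE; exact: able.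
    have hV := is_pdcV (f := fun y => \det (F y)) _ hd.
    have := is_pdcM (hV _) (is_pdcM (is_pdc_cst mu ((-1) ^+ (a.2 + a.1)) x) hc).
    rewrite -unitfE -unitmxE => /(_ Fx) hh; eexists; apply: near_is_pdc hh.
    by apply: filterS Fu => y Fy; rewrite /invmx Fy !mxE.
  have [d hd] := choice H; exists (\matrix_(i, j) d (i, j)) => i j.
  by rewrite mxE; exact: (hd (i, j)).
suff <- : E = - (invmx (F x) *m D *m invmx (F x)) by [].
have h1 : is_mpd mu (fun y => F y *m invmx (F y)) x (D *m invmx (F x) + F x *m E).
  exact: is_mpdM.
have h2 : is_mpd mu (fun y => F y *m invmx (F y)) x 0.
  apply: near_is_mpd (is_mpd_cst mu 1%:M x).
  by apply: filterS Fu => y Fy; rewrite mulmxV.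
have := is_mpdE h1; rewrite (is_mpdE h2) => /esym/eqP.
rewrite addrC addr_eq0 => /eqP h; rewrite -[LHS](mulKmx Fx) h.
by rewrite mulmxN mulmxA.
Qed.

End MatrixPartial.

(** * The chain rule along a moving complex argument *)

Section ChainRule.
Context {R : realType}.
Local Notation C := R[i].

Lemma is_derive_line (V W : normedModType R) (f : V -> W) x v :
  'D_v f x = 'D_1 (fun h : R => f (h *: v + x)) 0.
Proof.
rewrite /derive; set g1 := fun h => h^-1 *: _; set g2 := fun h => h^-1 *: _.
suff -> : g1 = g2 by [].
by apply/funext => h; rewrite /g1 /g2 /= addr0 scale0r add0r [_%:A]mulr1.
Qed.

Lemma is_derive_comp_pair (V : normedModType R) (F : (R * R) * V -> R) (al be : V -> R)
    x v da db :
  differentiable F ((al x, be x), x) ->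
  is_derive x v al da -> is_derive x v be db ->
  is_derive x v (fun y => F ((al y, be y), y))
    ('D_v (fun y => F ((al x, be x), y)) x + 'D_(da, db) (fun p => F (p, x)) (al x, be x)).
Proof.
move=> dF hal hbe.
pose G (t : R) := ((al (t *: v + x), be (t *: v + x)), t *: v + x).
have G0 : G 0 = ((al x, be x), x) by rewrite /G scale0r add0r.
have dal : differentiable (fun t : R => al (t *: v + x)) 0.
  by apply/derivable1_diffP; apply/(derivable1P al x v); case: hal.
have dbe : differentiable (fun t : R => be (t *: v + x)) 0.
  by apply/derivable1_diffP; apply/(derivable1P be x v); case: hbe.
have dline : differentiable (fun t : R => t *: v + x) 0 by [].
have dG : differentiable G 0.
  by apply: differentiable_pair => //; apply: differentiable_pair.
have eG : 'd G 0 1 = ((da, db), v).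
  rewrite /G diff_pair //; last exact: differentiable_pair.
  rewrite diff_pair // -!deriveE // -!is_derive_line !derive_val.
  by rewrite -(is_derive_line (fun y : V => y)) derive_id.
have dFG : differentiable (F \o G) 0 by apply: differentiable_comp => //; rewrite G0.
split; first by apply/derivable1P; apply/derivable1_diffP.
rewrite is_derive_line -[fun h => _]/(F \o G) deriveE // diff_comp ?G0 //= eG.
have -> : ((da, db), v) = (0, v) + ((da, db), 0) :> (R * R) * V.
  by apply: injective_projections; rewrite /= ?add0r ?addr0.
have derive_ext (U1 U2 : normedModType R) (f1 : U1 -> R) (f2 : U2 -> R) a1 a2 v1 v2 :
    (forall h : R, f1 (h *: v1 + a1) = f2 (h *: v2 + a2)) -> f1 a1 = f2 a2 ->
    'D_v1 f1 a1 = 'D_v2 f2 a2.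
  rewrite /derive => e1 e2; set g1 := fun h => h^-1 *: _; set g2 := fun h => h^-1 *: _.
  suff -> : g1 = g2 by [].
  by apply/funext => h; rewrite /g1 /g2 /= e1 e2.
rewrite linearD; set P0 := ((al x, be x), x) in dF *.
rewrite -(deriveE ((0, v) : (R * R) * V) dF) -(deriveE (((da, db), 0) : (R * R) * V) dF).
have -> : 'D_(0, v) F P0 = 'D_v (fun y => F ((al x, be x), y)) x.
  apply: (derive_ext _ _ F (fun y => F ((al x, be x), y)) P0 x (0, v) v) => [h|//].
  by rewrite /P0; congr (F _); apply: injective_projections; rewrite /= ?scaler0 ?add0r.
have -> // : 'D_((da, db), 0) F P0 = 'D_(da, db) (fun p => F (p, x)) (al x, be x).
apply: (derive_ext _ _ F (fun p => F (p, x)) P0 (al x, be x) ((da, db), 0) (da, db)) => [h|//].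
by rewrite /P0; congr (F _); apply: injective_projections; rewrite /= ?scaler0 ?add0r.
Qed.

(** The real directional derivatives of a complex-differentiable function, read
    through a real-linear functional [P] (the real or the imaginary part). *)
Lemma derive_complex_dir (f : C -> C) (l d : C) (P : C -> R) :
  derivable f l 1 -> continuous P -> (forall z w, P (z - w) = P z - P w) ->
  (forall (h : R) z, P (h%:C * z) = h * P z) ->
  'D_(complex.Re d, complex.Im d) (fun p => P (f (p.1 +i* p.2))) (complex.Re l, complex.Im l)
  = P (d * f^`()%classic l).
Proof.
move=> df cP PB PZ.
have -> : f^`()%classic l = 'D_1 f l by rewrite derive1E.
apply: cvg_lim => //.
have hf : h^-1 *: (f (h + l) - f l) @[h --> 0^'] --> 'D_1 f l.
  have := df; rewrite /derivable => /cvg_ex [e he].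
  have -> : 'D_1 f l = e by rewrite /derive (cvg_lim _ he).
  set g1 := fun h : C => _; suff -> : g1 = (fun h : C => h^-1 *: ((f \o shift l) (h *: 1) - f l)) by [].
  by apply/funext => h; rewrite /g1 /= [h *: 1]mulr1.
case: (eqVneq d 0) => [->|d0].
  rewrite mul0r.
  have P0 : P 0 = 0 by rewrite -(subrr 0) PB subrr.
  rewrite P0 (_ : (fun h => _) = fun=> 0); first exact: cvg_cst.
  apply/funext => h /=; rewrite !scaler0 !add0r.
  by rewrite subrr scaler0.
have hc : (h%:C * d : C) @[h --> (0 : R)^'] --> (0 : C)^'.
  move=> A [e /= /gt0_complexE[e0 eE] hA].
  have n0 : 0 < `|d| by rewrite normr_gt0.
  have [n0' nE] := gt0_complexE n0.
  exists (complex.Re e / complex.Re `|d|); first by rewrite /= divr_gt0.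
  move=> h /=; rewrite sub0r normrN => hh h0; apply: hA => /=.
    rewrite sub0r normrN normrM norm_real_complex nE eE -rmorphM ltcR.
    by rewrite -ltr_pdivlMr.
  by rewrite mulf_neq0 // fmorph_eq0.
have hh := cvg_comp _ _ (cvgM (cvg_cst d) (cvg_comp _ _ hc hf)) (cP _).
apply: (cvg_trans _ (hh _ _)); apply: near_eq_cvg; near=> h.
have h0 : h != 0 by near: h; exact: nbhs_dnbhs_neq.
have h0' : h%:C != 0 :> C by rewrite fmorph_eq0.
rewrite /=.
have -> : (h *: complex.Re d + complex.Re l) +i* (h *: complex.Im d + complex.Im l) = h%:C * d + l.
  by apply: complex_eqP; rewrite ?(cReD, cImD, cReM, cImM) /= mul0r ?subr0 ?addr0.
have -> : complex.Re l +i* complex.Im l = l by case: (l).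
rewrite -PB -[LHS](mulKf h0) -PZ; congr (_ * P _).
rewrite /GRing.scale /= invfM.
by field; rewrite d0 h0'.
Unshelve. all: by end_near. Qed.

(** Derivative of [f(la(y), y)] for [f] jointly real-differentiable, and complex
    differentiable in its first argument. *)
Lemma is_pdc_comp mu (f : C -> R * R -> C) (la : R * R -> C) (x : R * R) (d : C) :
  rdiff (fun p : (R * R) * (R * R) => f (p.1.1 +i* p.1.2) p.2)
    ((complex.Re (la x), complex.Im (la x)), x) ->
  derivable (f^~ x) (la x) 1 -> is_pdc mu la x d ->
  is_pdc mu (fun y => f (la y) y) x
    (pdc mu (f (la x)) x + d * (f^~ x)^`()%classic (la x)).
Proof.
move=> [d1 d2] df [h1 h2].
have E y : la y = complex.Re (la y) +i* complex.Im (la y) by case: (la y).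
split.
  rewrite cReD /= -(@derive_complex_dir (f^~ x) (la x) d (@complex.Re R)) //.
  - have := is_derive_comp_pair d1 h1 h2; rewrite /= -(E x).
    by under eq_fun do rewrite -E.
  - exact: Re_continuous.
  - by move=> z w; rewrite cReD cReN.
  - by move=> h z; rewrite cReM /= mul0r subr0.
rewrite cImD /= -(@derive_complex_dir (f^~ x) (la x) d (@complex.Im R)) //.
- have := is_derive_comp_pair d2 h1 h2; rewrite /= -(E x).
  by under eq_fun do rewrite -E.
- exact: Im_continuous.
- by move=> z w; rewrite cImD cImN.
- by move=> h z; rewrite cImM /= mul0r addr0.
Qed.

End ChainRule.

(** * The roots [lambda_k] *)

Section Roots.
Context {R : realType}.
Local Notation C := R[i].
Implicit Types (x y : R * R) (w l : C).

Lemma lam_in_quad w x :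
  lam_in w x ^+ 2 = 2%:R * (x.2%:C - w) * lam_in w x + x.1%:C ^+ 2.
Proof.
rewrite /lam_in; set s := sqrtC _.
have s2 : s ^+ 2 = (x.2%:C - w) ^+ 2 + x.1%:C ^+ 2 by rewrite sqrtCK.
have -> : x.1%:C ^+ 2 = s ^+ 2 - (x.2%:C - w) ^+ 2 by rewrite s2 addrC addKr.
by case: ifP => _; ring.
Qed.

Lemma lam_in_out_add w x : lam_in w x + lam_out w x = 2%:R * (x.2%:C - w).
Proof. by rewrite /lam_out addrC subrK. Qed.

Lemma lam_in_out_mul w x : lam_in w x * lam_out w x = - x.1%:C ^+ 2.
Proof.
have q := lam_in_quad w x; rewrite /lam_out mulrBr -[X in _ - X]expr2 q; ring.
Qed.

(** If the two roots have the same modulus [rho], they are [a] and [- conj a],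
    because their product is [- rho ^ 2]; then [w] is on the slit. *)
Lemma slit_of_conj w x (a : C) :
  (x.2%:C - w) + (x.2%:C - w) = a - a^*%R -> `|a| = x.1%:C -> slit x w.
Proof.
move=> e2 ea; have := norm_Im_le a; rewrite ea lecR.
case: a e2 ea => a1 a2; case: w => w1 w2 e2 _ /=.
have hr : x.2 - w1 + (x.2 - w1) = a1 - a1 := congr1 (@complex.Re R) e2.
have hi : (0 - w2) + (0 - w2) = a2 - - a2 := congr1 (@complex.Im R) e2.
move=> ha; split => /=; first lra.
have -> : w2 = - a2 by lra.
by rewrite normrN.
Qed.

Lemma lam_in_out_norm w x : half_plane x -> ~ slit x w ->
  `|lam_in w x| < x.1%:C /\ x.1%:C < `|lam_out w x|.
Proof.
move=> x0 nsl; have x0' : 0 < x.1%:C :> C by rewrite ltcR.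
have nx : `|x.1%:C : C| = x.1%:C by rewrite gtr0_norm.
have nmul (a b : C) : a * b = - x.1%:C ^+ 2 -> `|a| * `|b| = x.1%:C ^+ 2.
  by move=> e; rewrite -normrM e normrN normrX nx.
suff h : `|lam_in w x| < x.1%:C.
  split=> //; have e := nmul _ _ (lam_in_out_mul w x).
  rewrite -(ltr_pM2l x0') [ltLHS](_ : _ = `|lam_in w x| * `|lam_out w x|); last by rewrite e expr2.
  rewrite ltr_pM2r // normr_gt0.
  apply: contraTneq (x0) => l0; move/eqP: e; rewrite l0 normr0 mulr0 eq_sym expf_eq0 /=.
  by move=> /eqP [] ->; rewrite ltxx.
pose s := sqrtC ((x.2%:C - w) ^+ 2 + x.1%:C ^+ 2).
pose a := x.2%:C - w + s; pose b := x.2%:C - w - s.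
have s2 : s ^+ 2 = (x.2%:C - w) ^+ 2 + x.1%:C ^+ 2 by rewrite sqrtCK.
have ab : a * b = - x.1%:C ^+ 2.
  rewrite (_ : a * b = (x.2%:C - w) ^+ 2 - s ^+ 2); first by rewrite s2 opprD addNKr.
  by rewrite /a /b; ring.
rewrite /lam_in -/s -/a -/b; case: ifPn => // na.
have ha : x.1%:C <= `|a| by rewrite real_leNgt ?normr_real // gtr0_real.
case: (eqVneq `|a| x.1%:C) => [ea|nea].
  exfalso; apply: nsl.
  have a0 : a != 0 by rewrite -normr_eq0 ea gt_eqF.
  have eb : b = - a^*%R.
    apply: (mulfI a0); rewrite ab mulrN; congr (- _).
    by rewrite -normCK ea.
  have e2 : (x.2%:C - w) + (x.2%:C - w) = a - a^*%R by rewrite -eb /a /b; ring.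
  exact: slit_of_conj e2 ea.
have lta : x.1%:C < `|a| by rewrite lt_neqAle eq_sym nea.
have e := nmul _ _ ab.
have a0 : 0 < `|a| by exact: lt_trans lta.
by rewrite -(ltr_pM2l a0) e expr2 ltr_pM2r.
Qed.

Context {N : nat} (w : 'I_N -> C).
Hypothesis w_inj : injective w.
Hypothesis w_upper : forall k, 0 < complex.Im (w k).

(** The index [j] of the point [w j] to which the root [lambda_k] belongs. *)
Definition base_index (k : 'I_(N + N)) : 'I_N :=
  match fintype.split k with inl j => j | inr j => j end.

Lemma lam_quad k x :
  lam w k x ^+ 2 = 2%:R * (x.2%:C - w (base_index k)) * lam w k x + x.1%:C ^+ 2.
Proof.
rewrite /lam /base_index; case: (fintype.split k) => j; first exact: lam_in_quad.
have := lam_in_out_add (w j) x; have := lam_in_out_mul (w j) x.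
set a := lam_in _ _; set b := lam_out _ _ => h1 h2.
have -> : x.1%:C ^+ 2 = - (a * b) by rewrite h1 opprK.
by rewrite -h2; ring.
Qed.

Variables (x : R * R).
Hypothesis x_half : half_plane x.
Hypothesis x_slit : forall k, ~ slit x (w k).

Let x0 : 0 < x.1%:C :> C. Proof. by rewrite ltcR. Qed.

Lemma lam_norm_neq k : `|lam w k x| != x.1%:C.
Proof.
rewrite /lam; case: (fintype.split k) => j.
  by have [/lt_eqF -> _] := lam_in_out_norm x_half (x_slit (k := j)).
by have [_ /gt_eqF ->] := lam_in_out_norm x_half (x_slit (k := j)).
Qed.

Lemma lam_neq0 k : lam w k x != 0.
Proof.
apply/eqP => h; have := lam_quad k x; rewrite h mulr0 add0r expr0n /= => /esym/eqP.
by rewrite sqrf_eq0 gt_eqF.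
Qed.

Lemma lam_sqr_neq k : lam w k x ^+ 2 + x.1%:C ^+ 2 != 0.
Proof.
rewrite addr_eq0; apply: contra_neq (lam_norm_neq k) => /(congr1 Num.norm).
rewrite normrN !normrX (gtr0_norm x0) => /eqP.
by rewrite eqrXn2 ?normr_ge0 ?ltW // => /eqP.
Qed.

Lemma lam_base k : w (base_index k) =
  x.2%:C - (lam w k x ^+ 2 - x.1%:C ^+ 2) / (2%:R * lam w k x).
Proof.
have l0 := lam_neq0 k; rewrite lam_quad addrK.
by field; rewrite l0.
Qed.

Lemma lam_inj : injective (lam w ^~ x).
Proof.
move=> k k' /= e; have : w (base_index k) = w (base_index k').
  by rewrite !lam_base e.
move/w_inj => eb; apply: (can_inj splitK); move: e eb; rewrite /lam /base_index.
case: (fintype.split k) => j; case: (fintype.split k') => j' /= e ejj'.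
- by rewrite ejj'.
- have [h _] := lam_in_out_norm x_half (x_slit (k := j)).
  have [_ h'] := lam_in_out_norm x_half (x_slit (k := j')).
  by move: (lt_trans h h'); rewrite e ltxx.
- have [_ h] := lam_in_out_norm x_half (x_slit (k := j)).
  have [h' _] := lam_in_out_norm x_half (x_slit (k := j')).
  by move: (lt_trans h' h); rewrite e ltxx.
- by rewrite ejj'.
Qed.

Lemma lam_neq_conj k k' : lam w k x != (lam w k' x)^*%R.
Proof.
apply/eqP => e; have h : w (base_index k) = (w (base_index k'))^*%R.
  rewrite !lam_base e rmorphB fmorph_div rmorphB !rmorphXn rmorphM rmorph_nat /=.
  have cr (r : R) : (r%:C : C)^*%R = r%:C by exact: conjc_real.
  by rewrite !cr.
have := w_upper (base_index k); rewrite h.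
have -> : complex.Im (w (base_index k'))^*%R = - complex.Im (w (base_index k')).
  exact: cIm_conj.
by rewrite oppr_gt0 ltNge ltW ?w_upper.
Qed.
End Roots.

(** * Derivatives of the roots *)

Section RootDerivatives.
Context {R : realType}.
Local Notation C := R[i].

(** The coefficient [- d_mu varpi / d_l varpi] of the [l]-derivative in [Dop mu],
    in closed form. *)
Definition flow (mu : axis) (l : C) (x : R * R) : C :=
  match mu with
  | Rho => 2%:R * x.1%:C * l / (l ^+ 2 + x.1%:C ^+ 2)
  | Zed => 2%:R * l ^+ 2 / (l ^+ 2 + x.1%:C ^+ 2)
  end.

(** The choice of a square root in [lam_in] has no continuity by itself; the root
    is continuous because [(lam_in y - lam_in x) (lam_in y - lam_out x)] is small
    and the modulus keeps [lam_in y] away from [lam_out x]. *)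
Lemma lam_in_continuous (w : C) (x : R * R) :
  (\forall y \near x, half_plane y /\ ~ slit y w) ->
  lam_in w y @[y --> x] --> lam_in w x.
Proof.
move=> H; have [x0 xs] := nbhs_singleton H.
have [_ px] := lam_in_out_norm x0 xs.
set p' := lam_out w x in px *; set p := lam_in w x.
have p'0 : 0 < `|p'| by apply: lt_trans px; rewrite ltcR.
have [M0 ME] := gt0_complexE p'0; set M := complex.Re `|p'| in M0 ME.
have xM : x.1 < M by rewrite -ltcR -ME.
(* For [y] near [x], [r y] bounds the distance between the inner roots at [x] and
   at [y]. *)
pose r (y : R * R) := (2 * `|y.2 - x.2| * y.1 + `|y.1 ^+ 2 - x.1 ^+ 2|) / (M - y.1).
have r0 : r y @[y --> x] --> 0.
  have -> : 0 = (2 * `|x.2 - x.2| * x.1 + `|x.1 ^+ 2 - x.1 ^+ 2|) / (M - x.1).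
    by rewrite !subrr normr0 mulr0 mul0r addr0 mul0r.
  have c1 : y.1 @[y --> x] --> x.1 by exact: cvg_fst.
  have c2 : y.2 @[y --> x] --> x.2 by exact: cvg_snd.
  apply: cvgM; last first.
    by apply: cvgV; [rewrite subr_eq0 gt_eqF|apply: cvgB => //; exact: cvg_cst].
  apply: cvgD.
    apply: cvgM => //; apply: cvgM; first exact: cvg_cst.
    by apply: cvg_norm; apply: cvgB => //; exact: cvg_cst.
  apply: cvg_norm; apply: cvgB; last exact: cvg_cst.
  by rewrite expr2; under eq_fun do rewrite expr2; apply: cvgM.
have yM : \forall y \near x, y.1 < M.
  have c1 : y.1 @[y --> x] --> x.1 by exact: cvg_fst.
  exact: (cvgr_lt _ c1 _ xM).
apply: (iffRL (@cvgrPdist_lt C C (R * R) (nbhs x) _ _ _)) => e /gt0_complexE[e0 ->].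
near=> y.
have [y0 ys] : half_plane y /\ ~ slit y w by near: y.
have [py _] := lam_in_out_norm y0 ys.
have My : 0 < M - y.1 by rewrite subr_gt0; near: y.
suff h : `|lam_in w x - lam_in w y| <= (r y)%:C.
  apply: le_lt_trans h _; rewrite ltcR.
  near: y; exact: (cvgr_lt _ r0 _ e0).
rewrite /r rmorphM fmorphV /= ler_pdivlMr ?ltcR //.
have E : (lam_in w y - p) * (lam_in w y - p') =
   2%:R * (y.2%:C - x.2%:C) * lam_in w y + (y.1%:C ^+ 2 - x.1%:C ^+ 2).
  have := lam_in_quad w y; have := lam_in_out_add w x; have := lam_in_out_mul w x.
  rewrite -/p -/p'; set a := lam_in w y => e1 e2 e3.
  have -> : (a - p) * (a - p') = a ^+ 2 - (p + p') * a + p * p' by ring.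
  by rewrite e1 e2 e3; ring.
apply: (@le_trans _ _ (`|lam_in w y - p| * `|lam_in w y - p'|)).
  rewrite distrC; apply: ler_wpM2l => //; rewrite rmorphB /= -ME lerBlDr.
  have -> : p' = lam_in w y - (lam_in w y - p') by rewrite subKr.
  apply: le_trans (ler_normB _ _) _; rewrite subKr addrC lerD2l ltW //.
rewrite -normrM E; apply: le_trans (ler_normD _ _) _.
rewrite rmorphD !rmorphM /= -!norm_real_complex !rmorphB !rmorphXn /= rmorph_nat lerD2r.
rewrite !normrM normr_nat ler_wpM2l ?mulr_ge0 // ltW //.
Unshelve. all: by end_near. Qed.

(** The same factorization, divided by the increment of [y], gives the
    derivative. *)
Lemma is_pdc_lam_in mu (w : C) (x : R * R) :
  (\forall y \near x, half_plane y /\ ~ slit y w) ->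
  is_pdc mu (lam_in w) x (flow mu (lam_in w x) x).
Proof.
move=> H; have [x0 xs] := nbhs_singleton H.
have [px px'] := lam_in_out_norm x0 xs.
have pp' : lam_in w x - lam_out w x != 0.
  by rewrite subr_eq0; apply: contraTneq (lt_trans px px') => ->; rewrite ltxx.
have cl := lam_in_continuous H.
have cline : h *: dir mu + x @[h --> (0 : R)^'] --> x.
  apply: cvg_trans (_ : h *: dir mu + x @[h --> (0 : R)] --> x).
    by apply: cvg_app; exact: cvg_within.
  have : h *: dir mu + x @[h --> (0 : R)] --> 0 *: dir mu + x.
    by apply: cvgD; [apply: cvgZr_tmp|exact: cvg_cst].
  by rewrite scale0r add0r.
have cl' : lam_in w (h *: dir mu + x) @[h --> (0 : R)^'] --> lam_in w x.
  exact: cvg_comp _ _ cline cl.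
have csub : lam_in w (h *: dir mu + x) - lam_out w x @[h --> (0 : R)^'] -->
  lam_in w x - lam_out w x.
  by apply: cvgB; [exact: cl'|exact: cvg_cst].
have cden : (lam_in w (h *: dir mu + x) - lam_out w x)^-1 @[h --> (0 : R)^'] -->
  (lam_in w x - lam_out w x)^-1.
  exact: (cvgV pp' csub).
have E (y : R * R) : lam_in w y - lam_out w x != 0 -> lam_in w y - lam_in w x =
   (2%:R * (y.2%:C - x.2%:C) * lam_in w y + (y.1%:C ^+ 2 - x.1%:C ^+ 2)) /
   (lam_in w y - lam_out w x).
  move=> n0; apply: (mulIf n0); rewrite divfK //.
  have := lam_in_quad w y; have := lam_in_out_add w x; have := lam_in_out_mul w x.
  set a := lam_in w y; set p := lam_in w x; set p' := lam_out w x => e1 e2 e3.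
  have -> : (a - p) * (a - p') = a ^+ 2 - (p + p') * a + p * p' by ring.
  by rewrite e1 e2 e3; ring.
have nz : \forall h \near (0 : R)^', lam_in w (h *: dir mu + x) - lam_out w x != 0.
  have : \forall z \near lam_in w x, z != lam_out w x.
    have := @near_notin C [:: lam_out w x] (lam_in w x).
    rewrite inE -subr_eq0 => /(_ pp'); apply: filterS => z; by rewrite inE.
  move=> hz; have hz' : \forall h \near (0 : R)^', lam_in w (h *: dir mu + x) != lam_out w x.
    exact: (cl' _ hz).
  by apply: filterS hz' => h; rewrite subr_eq0.
have lx0 : lam_in w x != 0.
  apply/eqP => h; have := lam_in_quad w x; rewrite h mulr0 add0r expr0n /= => /esym/eqP.
  by rewrite sqrf_eq0 fmorph_eq0 gt_eqF.
have lo : lam_out w x = - x.1%:C ^+ 2 / lam_in w x.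
  by rewrite -(lam_in_out_mul w x) mulrC mulKf.
have sq0 : lam_in w x ^+ 2 + x.1%:C ^+ 2 != 0.
  have : lam_in w x * (lam_in w x - lam_out w x) != 0 by rewrite mulf_neq0.
  by rewrite mulrBr lam_in_out_mul opprK -expr2.
have de : lam_in w x - lam_out w x = (lam_in w x ^+ 2 + x.1%:C ^+ 2) / lam_in w x.
  by rewrite lo; field.
have ch : (h%:C : C) @[h --> (0 : R)^'] --> (0 : C).
  apply: cvg_trans (_ : (h%:C : C) @[h --> (0 : R)] --> (0 : C)).
    by apply: cvg_app; exact: cvg_within.
  by have := @real_complex_continuous R 0.
case: mu cline cl' csub cden nz => cline cl' csub cden nz.
- apply: (@is_pdc_slope _ _ _ _ _ (fun h => (2%:R * x.1%:C + h%:C) *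
      (lam_in w (h *: dir Rho + x) - lam_out w x)^-1)).
    have -> : flow Rho (lam_in w x) x = (2%:R * x.1%:C + 0) * (lam_in w x - lam_out w x)^-1.
      by rewrite de /=; field; rewrite sq0 lx0.
    by apply: cvgM; [apply: cvgD; [exact: cvg_cst|exact: ch]|exact: cden].
  apply: filterS nz => h n0; rewrite E //= scaler0 add0r subrr mulr0 mul0r add0r.
  rewrite [h *: 1]mulr1 rmorphD /=; set D := _^-1; ring.
- apply: (@is_pdc_slope _ _ _ _ _ (fun h => 2%:R * lam_in w (h *: dir Zed + x) *
      (lam_in w (h *: dir Zed + x) - lam_out w x)^-1)).
    have -> : flow Zed (lam_in w x) x = 2%:R * lam_in w x * (lam_in w x - lam_out w x)^-1.
      by rewrite de /=; field; rewrite sq0 lx0.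
    by apply: cvgM; [apply: cvgM; [exact: cvg_cst|exact: cl']|exact: cden].
  apply: filterS nz => h n0; rewrite E //= scaler0 add0r subrr addr0.
  rewrite [h *: 1]mulr1 rmorphD /=; set D := _^-1; ring.
Qed.

Lemma is_pdc_rho mu (x : R * R) :
  is_pdc mu (fun y : R * R => y.1%:C) x (if mu is Rho then 1 else 0).
Proof.
apply: (@is_pdc_slope _ _ _ _ _ (fun _ => if mu is Rho then 1 else 0)); first exact: cvg_cst.
near=> h; case: mu => /=; rewrite ?scaler0 ?add0r ?subrr ?mulr0 //.
by rewrite [h *: 1]mulr1 rmorphD /= addrK mulr1.
Unshelve. all: by end_near. Qed.

Lemma is_pdc_zed mu (x : R * R) :
  is_pdc mu (fun y : R * R => y.2%:C) x (if mu is Rho then 0 else 1).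
Proof.
apply: (@is_pdc_slope _ _ _ _ _ (fun _ => if mu is Rho then 0 else 1)); first exact: cvg_cst.
near=> h; case: mu => /=; rewrite ?scaler0 ?add0r ?subrr ?mulr0 //.
by rewrite [h *: 1]mulr1 rmorphD /= addrK mulr1.
Unshelve. all: by end_near. Qed.

Lemma is_pdc_lam_out mu (w : C) (x : R * R) :
  (\forall y \near x, half_plane y /\ ~ slit y w) ->
  is_pdc mu (lam_out w) x (flow mu (lam_out w x) x).
Proof.
move=> H; have [x0 xs] := nbhs_singleton H.
have [px px'] := lam_in_out_norm x0 xs.
have pp' : lam_in w x - lam_out w x != 0.
  by rewrite subr_eq0; apply: contraTneq (lt_trans px px') => ->; rewrite ltxx.
have h1 := is_pdcD (is_pdc_zed mu x) (is_pdcN (is_pdc_cst mu w x)).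
have h2 := is_pdcD (is_pdcM (is_pdc_cst mu (2%:R) x) h1) (is_pdcN (is_pdc_lam_in mu H)).
have -> : flow mu (lam_out w x) x =
  0 * (x.2%:C - w) + 2%:R * ((if mu is Rho then 0 else 1) + - 0) + - flow mu (lam_in w x) x.
  have mm := lam_in_out_mul w x.
  have x1 : x.1%:C != 0 :> C by rewrite fmorph_eq0 gt_eqF.
  have lx0 : lam_in w x != 0.
    by apply: contraNneq x1 => l0; move/eqP: mm; rewrite l0 mul0r eq_sym oppr_eq0 sqrf_eq0.
  have lo : lam_out w x = - x.1%:C ^+ 2 / lam_in w x.
    by rewrite -mm mulrC mulKf.
  have sq0 : lam_in w x ^+ 2 + x.1%:C ^+ 2 != 0.
    have : lam_in w x * (lam_in w x - lam_out w x) != 0 by rewrite mulf_neq0.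
    by rewrite mulrBr mm opprK -expr2.
  have sq1 : x.1%:C ^+ 2 + lam_in w x ^+ 2 != 0 by rewrite addrC.
  have hL : (lam_out w x ^+ 2 + x.1%:C ^+ 2) = x.1%:C ^+ 2 * (x.1%:C ^+ 2 + lam_in w x ^+ 2) / lam_in w x ^+ 2.
    by rewrite lo; field.
  case: mu {h1 h2} => /=; rewrite hL lo; field; rewrite ?sq0 ?sq1 ?lx0 ?x1 //.
exact: h2.
Qed.
End RootDerivatives.

Section RootFamily.
Context {R : realType}.
Local Notation C := R[i].
Context {N : nat} (w : 'I_N -> C) (x : R * R).
Hypothesis x_slit : \forall y \near x, half_plane y /\ forall j, ~ slit y (w j).

Let near_slit j : \forall y \near x, half_plane y /\ ~ slit y (w j).
Proof. by apply: filterS x_slit => y [h hs]; split. Qed.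

Lemma is_pdc_lam mu k : is_pdc mu (lam w k) x (flow mu (lam w k x) x).
Proof.
rewrite /lam; case: (fintype.split k) => j.
  exact: is_pdc_lam_in (near_slit j).
exact: is_pdc_lam_out (near_slit j).
Qed.

Lemma lam_continuous k : lam w k y @[y --> x] --> lam w k x.
Proof.
rewrite /lam; case: (fintype.split k) => j; first exact: lam_in_continuous (near_slit j).
rewrite /lam_out; apply: cvgB; last exact: lam_in_continuous (near_slit j).
apply: cvgM; first exact: cvg_cst.
apply: cvgB; last exact: cvg_cst.
have c2 : y.2 @[y --> x] --> x.2 by exact: cvg_snd.
exact: cvg_comp _ _ c2 (@real_complex_continuous R x.2).
Qed.

Lemma near_lam_neq l : (forall k, l != lam w k x) ->
  \forall y \near x, forall k, l != lam w k y.
Proof.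
move=> h; suff hk k : \forall y \near x, l != lam w k y.
  exact: (@filter_forall _ _ (fun k y => l != lam w k y) _ _ hk).
have hz : \forall z \near lam w k x, l != z.
  have hn : lam w k x \notin [:: l] by rewrite inE eq_sym.
  by apply: filterS (near_notin hn) => z; rewrite inE eq_sym.
have cl : lam w k y @[y --> x] --> lam w k x by exact: lam_continuous.
exact: (cl _ hz).
Qed.
End RootFamily.

(** * Hermitian conjugation and the reality condition *)

Section Adjoint.
Context {R : realType}.
Local Notation C := R[i].

Lemma adjM m n p (A : 'M[C]_(m, n)) (B : 'M[C]_(n, p)) :
  (A *m B) ^t* = B ^t* *m A ^t*.
Proof. by rewrite trmx_mul map_mxM. Qed.
Lemma adjK m n (A : 'M[C]_(m, n)) : (A ^t*) ^t* = A.
Proof. by apply/matrixP => i j; rewrite !mxE conjCK. Qed.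
Lemma adjD m n (A B : 'M[C]_(m, n)) : (A + B) ^t* = A ^t* + B ^t*.
Proof. by rewrite linearD map_mxD. Qed.
Lemma adjN m n (A : 'M[C]_(m, n)) : (- A) ^t* = - A ^t*.
Proof. by rewrite linearN map_mxN. Qed.
Lemma adjZ m n (a : C) (A : 'M[C]_(m, n)) : (a *: A) ^t* = a^*%R *: A ^t*.
Proof. by rewrite linearZ map_mxZ. Qed.
Lemma adj0 m n : (0 : 'M[C]_(m, n)) ^t* = 0.
Proof. by rewrite trmx0 map_mx0. Qed.
Lemma adj1 n : (1%:M : 'M[C]_n) ^t* = 1%:M.
Proof. by rewrite trmx1 map_mx1. Qed.
Lemma adj_sum m n (I : Type) (r : seq I) (F : I -> 'M[C]_(m, n)) :
  (\sum_(i <- r) F i) ^t* = \sum_(i <- r) (F i) ^t*.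
Proof.
elim: r => [|i r IH]; first by rewrite !big_nil adj0.
by rewrite !big_cons adjD IH.
Qed.
Lemma adj_inv n (A : 'M[C]_n) : (invmx A) ^t* = invmx (A ^t*).
Proof. by rewrite trmx_inv map_invmx. Qed.

Lemma invmx_eq n (A B : 'M[C]_n) : A *m B = 1%:M -> invmx A = B.
Proof. by move=> h; have [uA _] := mulmx1_unit h; rewrite -[RHS](mulKmx uA) h mulmx1. Qed.

Lemma adj_sqr_eq0 n (y : 'rV[C]_n) (z : 'rV[C]_n) :
  y *m y ^t* + z *m z ^t* = 0 -> y = 0.
Proof.
move=> /matrixP /(_ 0 0); rewrite !mxE => h.
have nn (t : 'rV[C]_n) : 0 <= \sum_j t 0 j * (t ^t*) j 0.
  by apply: sumr_ge0 => j _; rewrite !mxE mul_conjC_ge0.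
move/eqP: h; rewrite paddr_eq0 // => /andP[h _].
apply/rowP => j; rewrite mxE; apply/eqP; rewrite -mul_conjC_eq0.
move: h; rewrite psumr_eq0; last by move=> i _; rewrite !mxE mul_conjC_ge0.
by move=> /allP /(_ j); rewrite mem_index_enum !mxE => /(_ isT).
Qed.

(** A matrix involution [Gam] is Hermitian if [tau] is involutive at [Gam]. *)
Lemma tau_involutive_hermitian n (Gam : 'M[C]_n) :
  Gam *m Gam = 1%:M -> tau Gam (tau Gam Gam) = Gam -> Gam ^t* = Gam.
Proof.
move=> GG; have GG' : Gam ^t* *m Gam ^t* = 1%:M by rewrite -adjM GG adj1.
rewrite /tau (invmx_eq GG') !adjM adjK => h.
have e : (Gam ^t* *m (Gam *m Gam ^t*)) *m (Gam ^t* *m (Gam *m Gam ^t*)) = 1%:M.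
  by rewrite !mulmxA -[_ *m Gam ^t* *m Gam ^t*]mulmxA GG' mulmx1 -[_ *m Gam *m Gam]mulmxA GG mulmx1 GG'.
rewrite (invmx_eq e) in h.
pose P := Gam *m Gam ^t*.
have PP : P *m P = 1%:M.
  rewrite -[LHS]mulmx1 -GG /P !mulmxA; congr (_ *m _).
  by rewrite -[RHS]h !mulmxA.
(* [P] is positive semidefinite with square [1], so [P + 1] is invertible and
   [(P + 1) (P - 1) = 0] gives [P = 1]. *)
have PU : P + 1%:M \in unitmx.
  rewrite -row_free_unit; apply: inj_row_free => y /(congr1 (mulmxr (y ^t*))).
  rewrite /= mulmxDr mulmx1 mulmxDl mul0mx /P addrC => e0.
  apply: (@adj_sqr_eq0 _ y (y *m Gam)); rewrite -[RHS]e0; congr (_ + _).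
  by rewrite adjM !mulmxA.
have P1 : P = 1%:M.
  apply/eqP; rewrite -subr_eq0; apply/eqP; apply: (can_inj (mulKmx PU)).
  by rewrite mulmx0 mulmxBr mulmx1 mulmxDl PP mul1mx [P + _]addrC subrr.
by rewrite -[LHS]mul1mx -GG -mulmxA -/P P1 mulmx1.
Qed.

(** Elements of the image of the Cartan embedding preserve the form [Gam]. *)
Lemma cartan_image_form n (Gam : 'M[C]_n) (H : set 'M[C]_n) q :
  H `<=` [set A | A \in unitmx] ->
  Gam *m Gam = 1%:M -> Gam ^t* = Gam -> cartan_image Gam H q ->
  q \in unitmx /\ q *m Gam *m q ^t* = Gam.
Proof.
move=> Hu GG Gh [g [Hg tg] <-].
have gu : g \in unitmx by exact: Hu.
have gau : g ^t* \in unitmx by rewrite map_unitmx unitmx_tr.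
have gG : g *m Gam *m g ^t* = Gam.
  by rewrite -[X in X *m Gam]tg /tau -!mulmxA [X in _ *m (_ *m X)]mulmxA GG mul1mx mulVmx // mulmx1.
have Gu : Gam \in unitmx by case: (mulmx1_unit GG).
have su : sigma Gam g \in unitmx by rewrite /sigma !unitmx_mul Gu gu.
have sG : sigma Gam g *m Gam *m (sigma Gam g) ^t* = Gam.
  rewrite /sigma !adjM Gh -!mulmxA [X in _ *m (_ *m X)]mulmxA GG mul1mx.
  by rewrite [X in _ *m X]mulmxA [X in _ *m X]mulmxA gG mulmxA GG mul1mx.
move: (sigma Gam g) su sG => s su sG.
split; first by rewrite unitmx_mul gu unitmx_inv su.
have sau : s ^t* \in unitmx by rewrite map_unitmx unitmx_tr.
have e : invmx s *m Gam *m invmx (s ^t*) = Gam.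
  by rewrite -{1}sG -!mulmxA mulmxV // mulmx1 mulKmx.
by rewrite adjM adj_inv !mulmxA -[g *m _ *m _]mulmxA -[g *m _ *m _]mulmxA e.
Qed.

(** The current of a map that preserves the form [Gam] takes its values in the
    Lie algebra of the unitary group of this form: differentiate the identity
    [q Gam q^H = Gam]. *)
Lemma current_adj n (Gam : 'M[C]_n) (q : R * R -> 'M[C]_n) mu x :
  Gam *m Gam = 1%:M ->
  (\forall y \near x, q y \in unitmx /\ q y *m Gam *m (q y) ^t* = Gam) ->
  mdiff q x -> (current q mu x) ^t* = - (Gam *m current q mu x *m Gam).
Proof.
move=> GG nq dq; have [qu qG] := nbhs_singleton nq.
have hq := mdiff_is_mpd mu dq.
have := is_mpdM (is_mpdM hq (is_mpd_cst mu Gam x)) (is_mpd_adj hq).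
have h0 : is_mpd mu (fun y => q y *m Gam *m (q y) ^t*) x 0.
  apply: near_is_mpd (is_mpd_cst mu Gam x).
  by apply: filterS nq => y [].
move/is_mpdE; rewrite (is_mpdE h0) mulmx0 addr0 => e.
have eD : pd mu q x = - (current q mu x *m q x) by rewrite /current mulNmx opprK mulmxKV.
move: (current q mu x) eD e => W -> .
rewrite adjN adjM !mulNmx mulmxN.
have -> : W *m q x *m Gam *m (q x) ^t* = W *m Gam.
  by rewrite -!mulmxA [q x *m _]mulmxA qG.
rewrite [q x *m Gam *m _]mulmxA qG.
move/esym/eqP; rewrite -opprD oppr_eq0 addr_eq0 => /eqP e.
have e' : Gam *m W ^t* = - (W *m Gam) by rewrite e opprK.
by rewrite -[LHS]mul1mx -{1}GG -[LHS]mulmxA e' mulmxN mulmxA.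
Qed.
End Adjoint.

(** * The Lax form and the operator [D] *)

Section LaxForm.
Context {R : realType}.
Local Notation C := R[i].
Implicit Types (l p : C) (x : R * R) (mu : axis).

(** The denominator [l ^ 2 + rho ^ 2] of the Lax form. *)
Definition quad (x : R * R) (l : C) : C := l ^+ 2 + x.1%:C ^+ 2.

(** The numerator of the Lax form over [quad]. *)
Definition lax_numer {n} (W : axis -> R * R -> 'M[C]_n) mu (x : R * R) (l : C) : 'M[C]_n :=
  x.1%:C ^+ 2 *: W mu x + (l * x.1%:C) *: star W mu x.

Lemma lax_formE n (W : axis -> R * R -> 'M[C]_n) mu l x :
  lax_form W mu l x = (quad x l)^-1 *: lax_numer W mu x l.
Proof.
rewrite /lax_form /lax_numer /acoef /bcoef scalerDr !scalerA -/(quad x l).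
congr (_ *: _ + _ *: _); first exact: mulrC.
by rewrite mulrAC mulrC.
Qed.

Lemma lax_form_entry n (W : axis -> R * R -> 'M[C]_n) mu l x i j :
  lax_form W mu l x i j = (quad x l)^-1 * lax_numer W mu x l i j.
Proof. by rewrite lax_formE [LHS]mxE. Qed.

(** The slope of [flow mu] between [p] and [l], up to the denominator [quad x l]:
    see [flow_sub]. *)
Definition flow_slope mu (x : R * R) (p l : C) : C :=
  match mu with
  | Rho => 2%:R * x.1%:C * (x.1%:C ^+ 2 - l * p) / quad x p
  | Zed => 2%:R * x.1%:C ^+ 2 * (l + p) / quad x p
  end.

Lemma flow_sub mu x p l : quad x p != 0 -> quad x l != 0 ->
  flow mu l x - flow mu p x = (l - p) * flow_slope mu x p l / quad x l.
Proof.
by rewrite /quad => hp hl; case: mu; rewrite /= /quad; field; rewrite hp hl.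
Qed.

(** At [l = i rho] and [l = - i rho] the two components of the slope, and of the
    numerator of a Lax form, have the same ratio [l / rho]. *)
Lemma flow_slope_root x p l : x.1%:C != 0 :> C -> quad x l = 0 ->
  flow_slope Zed x p l = (l / x.1%:C) * flow_slope Rho x p l.
Proof.
move=> x0 hl; rewrite /= !mulrA; congr (_ / _).
have l2 : l ^+ 2 = - x.1%:C ^+ 2 by apply/eqP; rewrite -addr_eq0; apply/eqP.
have -> : l / x.1%:C * 2%:R * x.1%:C * (x.1%:C ^+ 2 - l * p) =
  2%:R * (l * x.1%:C ^+ 2 - l ^+ 2 * p) by field.
by rewrite l2; ring.
Qed.

Lemma lax_numer_root n (W : axis -> R * R -> 'M[C]_n) x l :
  x.1%:C != 0 :> C -> quad x l = 0 ->
  lax_numer W Zed x l = (l / x.1%:C) *: lax_numer W Rho x l.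
Proof.
move=> x0 hl; have l2 : l ^+ 2 = - x.1%:C ^+ 2 by apply/eqP; rewrite -addr_eq0; apply/eqP.
rewrite /lax_numer /= scalerDr !scalerA scalerN -scaleNr addrC; congr (_ *: _ + _ *: _).
  by field.
have -> : - (l / x.1%:C * (l * x.1%:C)) = - l ^+ 2 by field.
by rewrite l2 opprK.
Qed.

Lemma is_pdc_varpi mu l x : l != 0 ->
  is_pdc mu (varpi l) x (if mu is Rho then x.1%:C / l else 1).
Proof.
move=> l0; rewrite /varpi.
have h1 := is_pdcM (is_pdcM (is_pdc_rho mu x) (is_pdc_rho mu x)) (is_pdc_cst mu (2%:R * l)^-1 x).
have h := is_pdcD (is_pdcD h1 (is_pdc_zed mu x)) (is_pdcN (is_pdc_cst mu (l / 2%:R) x)).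
have e (d d' : C) : is_pdc mu (varpi l) x d -> d = d' -> is_pdc mu (varpi l) x d' by move=> ? <-.
by apply: (e _ _ h); case: mu {h1 h e}; field.
Qed.

Lemma derive_varpi l x : l != 0 ->
  (varpi^~ x)^`()%classic l = - quad x l / (2%:R * l ^+ 2).
Proof.
move=> l0; rewrite derive1E.
have n2 : 2%:R != 0 :> C by rewrite pnatr_eq0.
have h1 : is_derive l 1 (fun z : C => 2%:R * z) 2%:R.
  have := is_deriveM (is_derive_cst (2%:R : C) l (1 : C)) (is_derive_id l (1 : C)).
  by rewrite scaler0 addr0 [_ *: _]mulr1.
have h2 : is_derive l 1 (fun z : C => (2%:R * z)^-1) (- (2%:R * l) ^- 2 * 2%:R).
  have n0 : 2%:R * l != 0 by rewrite mulf_neq0.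
  split; first by apply: derivableV => //; case: h1.
  by rewrite deriveV; [rewrite derive_val|by []|by case: h1].
have h3 := is_deriveM (is_derive_cst (x.1%:C ^+ 2) l (1 : C)) h2.
have h4 := is_deriveM (is_derive_id l (1 : C)) (is_derive_cst (2%:R^-1 : C) l (1 : C)).
have h5 := is_deriveB (is_deriveD h3 (is_derive_cst (x.2%:C) l (1 : C))) h4.
have := @derive_val _ _ _ _ _ _ _ h5; rewrite -[_ + _ - _]/(varpi^~ x) => ->.
rewrite !scaler0 !addr0 !add0r /GRing.scale /= /quad.
by field; rewrite l0.
Qed.

Lemma Dop_coefE mu l x : l != 0 -> quad x l != 0 ->
  pdc mu (varpi l) x / (varpi^~ x)^`()%classic l = - flow mu l x.
Proof.
move=> l0 q0; rewrite derive_varpi // (is_pdcE (is_pdc_varpi mu x l0)).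
move: q0; rewrite /quad => q0.
by case: mu => /=; rewrite /quad; field; rewrite q0 l0.
Qed.

Lemma DopE n mu (F : C -> R * R -> 'M[C]_n) l x D1 D2 : l != 0 -> quad x l != 0 ->
  is_mpd mu (F l) x D1 -> is_mderive (F^~ x) l D2 ->
  Dop mu F l x = D1 + flow mu l x *: D2.
Proof.
move=> l0 q0 h1 h2; rewrite /Dop Dop_coefE // scaleNr opprK (is_mpdE h1).
congr (_ + _ *: _); apply/matrixP => i j; rewrite mxE derive1E.
by have [_ ->] := h2 i j.
Qed.

Lemma flow_conj mu l x : (flow mu l^*%R x)^*%R = flow mu l x.
Proof.
have cr : (x.1%:C : C)^*%R = x.1%:C by exact: conjc_real.
have c2 : (2%:R : C)^*%R = 2%:R by rewrite rmorph_nat.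
case: mu; rewrite /=; move: (2%:R : C) c2 => t ct.
  by rewrite fmorph_div !rmorphM rmorphD !rmorphXn /= ct !conjCK !cr.
by rewrite fmorph_div !rmorphM rmorphD !rmorphXn /= ct !conjCK !cr.
Qed.

Lemma quad_conj l x : (quad x l^*%R)^*%R = quad x l.
Proof.
have cr : (x.1%:C : C)^*%R = x.1%:C by exact: conjc_real.
by rewrite /quad rmorphD !rmorphXn /= conjCK cr.
Qed.

Lemma sandwichZ n (G K M : 'M[C]_n) (c : C) : G *m (c *: M) *m K = c *: (G *m M *m K).
Proof. by rewrite -scalemxAr -scalemxAl. Qed.

Lemma half_sum n (M1 M2 : 'M[C]_n) :
  2%:R^-1 *: (M1 + M2) - (- 2%:R^-1) *: (M1 - M2) = M1.
Proof.
apply/matrixP => i j; rewrite !mxE.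
by have n2 : 2%:R != 0 :> C by []; field.
Qed.

Lemma half_diff n (M1 M2 : 'M[C]_n) :
  2%:R^-1 *: (M1 + M2) - 2%:R^-1 *: (M1 - M2) = M2.
Proof. by apply/matrixP => i j; rewrite !mxE; field. Qed.

Lemma cancel_denoms (a c q z : C) : a != 0 -> q != 0 -> c != 0 ->
  z = a * (c * q * z) / (a * q * c).
Proof. by move=> a0 q0 c0; field; rewrite a0 q0 c0. Qed.

Lemma cancel_denoms2 (a c q z : C) : a != 0 -> q != 0 -> c != 0 ->
  q^-1 * z = a * (c * z) / (a * q * c).
Proof. by move=> a0 q0 c0; field; rewrite a0 q0 c0. Qed.

Lemma row_parallel n (d t z : 'rV[C]_n) (a : 'cV[C]_n) (M : 'M[C]_n) : M \in unitmx ->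
  d *m invmx M = z *m (a *m t *m invmx M) -> d = (z *m a) *m t.
Proof.
move=> Mu /(congr1 (fun y : 'rV[C]_n => y *m M)).
by rewrite mulmxKV // -!mulmxA mulVmx // mulmx1.
Qed.

Lemma slope_scale n (a b : C) (Q1 Q2 M : 'M[C]_n) :
  0 *: Q1 - (a * b) *: M = a *: (0 *: Q2 - b *: M).
Proof. by rewrite !scale0r !sub0r scalerN scalerA. Qed.

Lemma sandwich3 n (G L M K : 'M[C]_n) : G *m G = 1%:M ->
  (G *m L *m G) *m ((G *m M *m G) *m (G *m K *m G)) = G *m (L *m M *m K) *m G.
Proof.
have GK (Z : 'M[C]_n) : G *m G = 1%:M -> G *m (G *m Z) = Z by rewrite mulmxA => ->; rewrite mul1mx.
by move=> GG; rewrite -!mulmxA !GK.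
Qed.

Lemma mul_kernel n (a b : 'cV[C]_n) (y z : 'rV[C]_n) (M K : 'M[C]_n) :
  y *m M *m K = 0 -> (a *m y + b *m z) *m M *m K = b *m (z *m M *m K).
Proof.
by move=> h; rewrite !mulmxDl -[a *m y *m M]mulmxA -[a *m _ *m K]mulmxA h mulmx0 add0r !mulmxA.
Qed.

Lemma lax_form_adj n (Gam : 'M[C]_n) (W : axis -> R * R -> 'M[C]_n) mu l x :
  (forall nu, (W nu x) ^t* = - (Gam *m W nu x *m Gam)) ->
  (lax_form W mu l^*%R x) ^t* = - (Gam *m lax_form W mu l x *m Gam).
Proof.
move=> hW; have qV : ((quad x l^*%R)^-1)^*%R = (quad x l)^-1 by rewrite fmorphV /= quad_conj.
have cr : (x.1%:C : C)^*%R = x.1%:C by exact: conjc_real.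
have c2 : (x.1%:C ^+ 2 : C)^*%R = x.1%:C ^+ 2 by rewrite rmorphXn /= cr.
have cl : (l^*%R * x.1%:C)^*%R = l * x.1%:C by rewrite rmorphM /= conjCK cr.
have hS : (star W mu x) ^t* = - (Gam *m star W mu x *m Gam).
  by case: mu; rewrite /= ?adjN hW // mulmxN mulNmx.
rewrite !lax_formE adjZ qV sandwichZ -scalerN; congr (_ *: _).
rewrite /lax_numer adjD [X in X + _]adjZ [X in _ + X]adjZ c2 cl hW hS.
by rewrite mulmxDr mulmxDl !sandwichZ opprD !scalerN.
Qed.

End LaxForm.

(** * The dressing matrix and its inverse *)

Section Dressing.
Context {R : realType} {n N : nat}.
Local Notation C := R[i].
Variables (Gam : 'M[C]_n) (q0 : R * R -> 'M[C]_n).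
Variables (w : 'I_N -> C) (Psi0 : C -> R * R -> 'M[C]_n) (U : set (R * R)).
Variables (u v : 'I_(N + N) -> R * R -> 'cV[C]_n).
Implicit Types (l : C) (x : R * R) (mu : axis).

Hypothesis GG : Gam *m Gam = 1%:M.
Hypothesis Gh : Gam ^t* = Gam.
Hypothesis current_real : forall x, half_plane x -> forall mu,
  (current q0 mu x) ^t* = - (Gam *m current q0 mu x *m Gam).
Hypothesis w_inj : injective w.
Hypothesis w_upper : forall k, 0 < complex.Im (w k).
Hypothesis U_open : open U.
Hypothesis U_half : U `<=` half_plane.
Hypothesis U_slit : forall x, U x -> forall k, ~ slit x (w k).
Hypothesis Psi_unit : forall x, U x -> forall k, Psi0k w Psi0 k x \in unitmx.
Hypothesis Psi_pd : forall x, U x -> forall k mu, is_mpd mu (Psi0k w Psi0 k) x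
  (- (lax_form (current q0) mu (lam w k x) x *m Psi0k w Psi0 k x)).
Hypothesis data : dressing_data Gam w Psi0 U u v.

(** At each [x]: the poles [p] and residues [A] of [chi], written [X], and the
    poles [p'] and residues [B] of the matrix [X'] that turns out to be its
    inverse. *)
Let p x k := lam w k x.
Let p' x k := (lam w k x)^*%R.
Let A x k := dressing_residue w Psi0 u v k x.
Let B x k := Gam *m (A x k) ^t* *m Gam.
Let X l x := chi w Psi0 u v l x.
Let X' l x := unit_pfrac (p' x) (B x) l.

Let chiE l x : X l x = unit_pfrac (p x) (A x) l. Proof. by []. Qed.

Let near_U x : U x -> \forall y \near x, U y.
Proof. by move=> Ux; apply: open_nbhs_nbhs. Qed.

Let near_slit x : U x -> \forall y \near x, half_plane y /\ forall j, ~ slit y (w j).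
Proof.
move=> Ux; apply: filterS (near_U Ux) => y Uy.
by split; [exact: U_half|exact: U_slit].
Qed.

Lemma chi_hatE l x : X' l x = Gam *m (X l^*%R x) ^t* *m Gam.
Proof.
rewrite chiE /X' /unit_pfrac adjD adj1 mulmxDr mulmx1 mulmxDl GG; congr (_ + _).
rewrite adj_sum mulmx_sumr mulmx_suml; apply: eq_bigr => k _.
rewrite adjZ -scalemxAr -scalemxAl; congr (_ *: _).
by rewrite fmorphV rmorphB /= conjCK.
Qed.

Lemma chi_adj l x : (X l^*%R x) ^t* = Gam *m X' l x *m Gam.
Proof.
by rewrite chi_hatE !mulmxA GG mul1mx -mulmxA GG mulmx1.
Qed.

Lemma chi_hat_adj l x : (X' l^*%R x) ^t* = Gam *m X l x *m Gam.
Proof. by rewrite chi_hatE !adjM Gh adjK conjCK mulmxA. Qed.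

(** The linear system says that the row [v_k^H Psi_0k^-1] is in the left kernel of
    the inverse of [chi] at [lambda_k]. *)
Lemma system_kernel x k : U x ->
  ((v k x) ^t* *m invmx (Psi0k w Psi0 k x)) *m X' (p x k) x = 0.
Proof.
move=> Ux; have [_ /(_ k)] := data.2 x Ux.
rewrite /X' /unit_pfrac mulmxDr mulmx1 => h.
suff -> : (v k x) ^t* *m invmx (Psi0k w Psi0 k x) *m
    (\sum_j (p x k - p' x j)^-1 *: B x j) =
  (\sum_j (lam w k x - (lam w j x)^*%R)^-1 *:
     ((v k x) ^t* *m Smx Gam w Psi0 k j x *m v j x *m (u j x) ^t*)) *m Gam.
  by rewrite h mulNmx -[_ *m Gam *m Gam]mulmxA GG mulmx1 subrr.
rewrite mulmx_sumr mulmx_suml; apply: eq_bigr => j _.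
rewrite -scalemxAr -scalemxAl; congr (_ *: _).
by rewrite /B /A /dressing_residue /Smx !adjM adj_inv adjK !mulmxA.
Qed.

Lemma residue_hat0 x k : U x -> A x k *m X' (p x k) x = 0.
Proof.
move=> Ux; rewrite /A /dressing_residue -[_ *m invmx _]mulmxA -mulmxA.
by rewrite system_kernel // mulmx0.
Qed.

Lemma chi_residue_hat0 x k : U x -> X (p' x k) x *m B x k = 0.
Proof.
move=> Ux; have := congr1 (fun M : 'M[C]_n => M ^t*) (residue_hat0 k Ux).
have e : p x k = (p' x k)^*%R by rewrite /p' conjCK.
rewrite adjM adj0 e chi_hat_adj => h.
have : Gam *m (Gam *m X (p' x k) x *m Gam *m (A x k) ^t*) *m Gam = 0.
  by rewrite h mulmx0 mul0mx.
by rewrite /B !mulmxA GG mul1mx.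
Qed.

Lemma poles_neq x i j : U x -> p x i != p' x j.
Proof. by move=> Ux; apply: lam_neq_conj; [exact: w_upper|exact: U_half]. Qed.

Lemma chi_mul_hat x l : U x -> (forall k, l != p x k) -> (forall k, l != p' x k) ->
  X l x *m X' l x = 1%:M.
Proof.
move=> Ux lp lp'; rewrite chiE /X'; apply: unit_pfrac_mul => // [i j|i|j].
- exact: poles_neq.
- exact: residue_hat0.
- exact: chi_residue_hat0.
Qed.

(** The partial derivative of the residue. *)
Let Q mu x k := pd mu (fun y => A y k) x.

(** The derivative of [Psi_0k^-1] contributes the Lax form at [lambda_k]. *)
Lemma is_mpd_residue_explicit mu x k : U x -> is_mpd mu (fun y => A y k) x
  ((pd mu (u k) x *m (v k x) ^t* + u k x *m (pd mu (v k) x) ^t*) *m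
     invmx (Psi0k w Psi0 k x)
   + A x k *m lax_form (current q0) mu (p x k) x).
Proof.
move=> Ux; have [du dv _ _] := data.1 x Ux k.
have hP : is_mpd mu (fun y => invmx (Psi0k w Psi0 k y)) x
    (invmx (Psi0k w Psi0 k x) *m lax_form (current q0) mu (p x k) x).
  have h := is_mpd_inv _ (Psi_pd Ux k mu).
  have -> : invmx (Psi0k w Psi0 k x) *m lax_form (current q0) mu (p x k) x =
    - (invmx (Psi0k w Psi0 k x) *m - (lax_form (current q0) mu (lam w k x) x *m Psi0k w Psi0 k x)
        *m invmx (Psi0k w Psi0 k x)).
    by rewrite mulmxN mulNmx opprK mulmxA -[RHS]mulmxA mulmxV ?mulmx1 ?Psi_unit.
  apply: h; apply: filterS (near_U Ux) => y Uy; exact: Psi_unit.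
have := is_mpdM (is_mpdM (mdiff_is_mpd mu du) (is_mpd_adj (mdiff_is_mpd mu dv))) hP.
by rewrite /A /dressing_residue [_ *m (invmx _ *m _)]mulmxA.
Qed.

Lemma residue_pdE mu x k : U x -> Q mu x k =
  (pd mu (u k) x *m (v k x) ^t* + u k x *m (pd mu (v k) x) ^t*) *m
     invmx (Psi0k w Psi0 k x)
   + A x k *m lax_form (current q0) mu (p x k) x.
Proof. by move=> Ux; exact: is_mpdE (is_mpd_residue_explicit mu k Ux). Qed.

Lemma is_mpd_residue mu x k : U x -> is_mpd mu (fun y => A y k) x (Q mu x k).
Proof. by move=> Ux; rewrite residue_pdE //; exact: is_mpd_residue_explicit. Qed.

(** The partial derivative of [chi] along [mu] at fixed [l]. *)
Definition chi_pd mu x l := \sum_k ((- (l - p x k)^-1 * - flow mu (p x k) x * (l - p x k)^-1) *: A x k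
   + (l - p x k)^-1 *: Q mu x k).

Lemma is_mpd_chi mu x l : U x -> (forall k, l != p x k) ->
  is_mpd mu (X l) x (chi_pd mu x l).
Proof.
move=> Ux lp.
have h k : is_mpd mu (fun y => (l - p y k)^-1 *: A y k) x
   ((- (l - p x k)^-1 * - flow mu (p x k) x * (l - p x k)^-1) *: A x k
   + (l - p x k)^-1 *: Q mu x k).
  apply: is_mpdZ; last exact: is_mpd_residue.
  have := is_pdcD (is_pdc_cst mu l x) (is_pdcN (is_pdc_lam (near_slit Ux) mu k)).
  have n0 : l - p x k != 0 by rewrite subr_eq0.
  by rewrite add0r => h; exact: (is_pdcV n0 h).
have := is_mpdD (is_mpd_cst mu 1%:M x) (is_mpd_sum (index_enum 'I_(N + N)) h).
by rewrite add0r.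
Qed.

(** The derivative of [chi] in [l]. *)
Definition chi_dl x l := \sum_k (- (l - p x k) ^- 2) *: A x k.

Lemma is_mderive_chi x l : (forall k, l != p x k) -> is_mderive (X^~ x) l (chi_dl x l).
Proof. exact: is_mderive_unit_pfrac. Qed.

(** The value of [Dop mu chi]. *)
Definition chi_D mu x l := chi_pd mu x l + flow mu l x *: chi_dl x l.

Lemma is_mderive_chi_hat x l : (forall k, l != p' x k) ->
  is_mderive (X'^~ x) l (Gam *m (chi_dl x l^*%R) ^t* *m Gam).
Proof.
move=> lp; have := is_mderive_unit_pfrac (B x) lp.
suff -> : \sum_k (- (l - p' x k) ^- 2) *: B x k = Gam *m (chi_dl x l^*%R) ^t* *m Gam by [].
rewrite /chi_dl adj_sum mulmx_sumr mulmx_suml; apply: eq_bigr => k _.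
rewrite adjZ -scalemxAr -scalemxAl; congr (_ *: _).
by rewrite rmorphN fmorphV rmorphXn rmorphB /= conjCK.
Qed.

Lemma is_mpd_chi_hat mu x l : U x -> (forall k, l != p' x k) ->
  is_mpd mu (X' l) x (Gam *m (chi_pd mu x l^*%R) ^t* *m Gam).
Proof.
move=> Ux lp.
have lp' k : l^*%R != p x k.
  by apply: contra_neq (lp k) => e; rewrite -[LHS]conjCK e.
have := is_mpd_mul_cst Gam Gam (is_mpd_adj (is_mpd_chi mu Ux lp')).
by under eq_fun do rewrite -chi_hatE.
Qed.

(** [D (X X') = 0]; conjugation by [Gam] turns [D X] at [conj l] into [D X'] at
    [l]. *)
Lemma chi_D_hat mu x l : U x -> (forall k, l != p x k) -> (forall k, l != p' x k) ->
  X l x *m (Gam *m (chi_D mu x l^*%R) ^t* *m Gam) = - (chi_D mu x l *m X' l x).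
Proof.
move=> Ux lp lp'.
have near1 : \forall y \near x, X l y *m X' l y = 1%:M.
  have lc k : l^*%R != p x k.
    by apply: contra_neq (lp' k) => e; rewrite -[LHS]conjCK e.
  have h1 := near_lam_neq (near_slit Ux) lp.
  have h2 := near_lam_neq (near_slit Ux) lc.
  near=> y; apply: chi_mul_hat.
  - by near: y; exact: near_U.
  - by near: y.
  - move=> k; have hk : forall k, l^*%R != lam w k y by near: y.
    by apply: contra_neq (hk k) => ->; rewrite /p' conjCK.
have near2 : \forall z \near l, X z x *m X' z x = 1%:M.
  pose E := codom (p x) ++ codom (p' x).
  have lE : l \notin E.
    rewrite mem_cat negb_or; apply/andP; split; apply/codomP => -[k e].
      by move: (lp k); rewrite e eqxx.
    by move: (lp' k); rewrite e eqxx.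
  near=> z; have : z \notin E by near: z; exact: near_notin.
  rewrite mem_cat negb_or => /andP[/codomP z1 /codomP z2].
  apply: chi_mul_hat => // k; apply/eqP => e; [apply: z1|apply: z2]; by exists k.
have e1 := is_mpdM (is_mpd_chi mu Ux lp) (is_mpd_chi_hat mu Ux lp').
have := is_mpdE e1; rewrite (is_mpdE (near_is_mpd _ (is_mpd_cst mu 1%:M x))); last first.
  by apply: filterS near1 => y ->.
have e2 := is_mderiveM (is_mderive_chi lp) (is_mderive_chi_hat lp').
have := is_mderive_near_cst near2 e2 => {}e2 {}e1.
rewrite /chi_D adjD adjZ flow_conj mulmxDr mulmxDl mulmxDr [X in _ = - X]mulmxDl.
rewrite -scalemxAr -!scalemxAl -scalemxAr.
move/eqP: e1; rewrite eq_sym addrC addr_eq0 => /eqP ->.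
move/eqP: e2; rewrite addrC addr_eq0 => /eqP ->.
by rewrite scalerN opprD.
Unshelve. all: by end_near. Qed.

(** * The numerator of the dressed form *)


Let N0 mu x := lax_numer (current q0) mu x.
Let g mu x k l := flow_slope mu x (p x k) l.

(** An entire function of [l] which, off [singular_points], is the dressed form
    multiplied by [quad] and by the factors of all the poles of [chi] and of its
    inverse. *)
Definition dressed_form_numer mu x l : 'M[C]_n :=
  dressed_numer (p x) (p' x) (A x) (B x) (Q mu x) (quad x) (N0 mu x) (g mu x) l.

(** The points where the formula for the dressed form may fail: the zeros of
    [quad], the poles of [chi] and of its inverse, and the origin, where [varpi]
    and hence [Dop] are meaningless. *)
Definition singular_points x : seq C :=
  [:: 0; 'i%C * x.1%:C; - ('i%C * x.1%:C)] ++ codom (p x) ++ codom (p' x).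

Let rho_neq0 x : U x -> x.1%:C != 0 :> C.
Proof. by move=> Ux; rewrite fmorph_eq0 gt_eqF //; exact: U_half. Qed.

Let quad_factor x l : quad x l = (l - 'i%C * x.1%:C) * (l - - ('i%C * x.1%:C)).
Proof.
rewrite /quad opprK -subr_sqr exprMn sqr_i mulN1r opprK; by [].
Qed.

Let quad_pole x k : U x -> quad x (p x k) != 0.
Proof. by move=> Ux; apply: lam_sqr_neq; [exact: U_half|exact: U_slit]. Qed.

Let quad_pole' x k : U x -> quad x (p' x k) != 0.
Proof.
move=> Ux; have := quad_pole k Ux; rewrite -(quad_conj (p x k)) => h.
by apply: contra_neq h => ->; rewrite rmorph0.
Qed.

Lemma singular_points_prod x l :
  \prod_(e <- singular_points x) (l - e) =
  l * quad x l * (\prod_k (l - p x k) * \prod_k (l - p' x k)).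
Proof.
rewrite /singular_points !big_cat /= !big_cons big_nil subr0 mulr1 quad_factor !mulrA.
by rewrite !big_image.
Qed.

Lemma singular_points_notin x l : l \notin singular_points x ->
  [/\ l != 0, quad x l != 0, forall k, l != p x k & forall k, l != p' x k].
Proof.
rewrite /singular_points !mem_cat !inE !negb_or => /andP[/and3P[l0 l1 l2] /andP[/codomP c1 /codomP c2]].
split=> //.
- by rewrite quad_factor mulf_neq0 // subr_eq0.
- by move=> k; apply/eqP => e; apply: c1; exists k.
- by move=> k; apply/eqP => e; apply: c2; exists k.
Qed.

Lemma singular_points_conj x l : l \notin singular_points x -> l^*%R \notin singular_points x.
Proof.
move=> /singular_points_notin[l0 ql lp lp'].
rewrite /singular_points !mem_cat !inE !negb_or conjC_eq0 l0 /=.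
have : quad x l^*%R != 0.
  by apply: contra_neq ql => h; rewrite -(quad_conj l) h rmorph0.
rewrite quad_factor mulf_eq0 negb_or !subr_eq0 => /andP[-> ->] /=.
apply/andP; split; apply/codomP => -[k e].
  by move: (lp' k); rewrite -[l]conjCK e eqxx.
by move: (lp k); rewrite -[l]conjCK e /p' conjCK eqxx.
Qed.

Lemma singular_points_uniq x : U x -> uniq (singular_points x).
Proof.
move=> Ux.
have i0 : 'i%C * x.1%:C != 0 :> C.
  rewrite mulf_neq0 ?rho_neq0 //; apply/eqP => /(congr1 (fun z : C => z ^+ 2)).
  by rewrite sqr_i expr0n /= => /eqP; rewrite oppr_eq0 oner_eq0.
have qi : quad x ('i%C * x.1%:C) = 0 by rewrite quad_factor subrr mul0r.
have qi' : quad x (- ('i%C * x.1%:C)) = 0 by rewrite quad_factor [X in _ * X]subrr mulr0.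
have p0 k : p x k != 0 by apply: lam_neq0; [exact: U_half].
have pinj : injective (p x) by apply: lam_inj; [exact: w_inj|exact: U_half|exact: U_slit].
have p'inj : injective (p' x) by move=> i j /(can_inj (@conjCK _)) /pinj.
rewrite /singular_points !cat_uniq; apply/and3P; split.
- rewrite /= !inE negb_or andbT [0 == _]eq_sym i0 [0 == _]eq_sym oppr_eq0 i0 /=.
  by rewrite -addr_eq0 -mulr2n mulrn_eq0 negb_or i0.
- apply/hasPn => z; rewrite mem_cat => /orP[] /codomP[k ->]; rewrite !inE !negb_or.
    rewrite p0 /=; apply/andP; split; apply: contra_neq (quad_pole k Ux) => -> //.
  rewrite conjC_eq0 p0 /=.
  apply/andP; split; apply: contra_neq (quad_pole' k Ux) => -> //.
- apply/and3P; split; [exact/injectiveP| |exact/injectiveP].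
  apply/hasPn => z /codomP[k ->]; apply/codomP => -[j e].
  by move: (poles_neq j k Ux); rewrite e eqxx.
Qed.

Lemma dressed_formE mu x l : U x -> l \notin singular_points x ->
  dressed_form w Psi0 q0 u v mu l x =
  dressed (p x) (p' x) (A x) (B x) (Q mu x) (quad x) (N0 mu x) (g mu x) l.
Proof.
move=> Ux /singular_points_notin[l0 ql lp lp']; rewrite /dressed_form /dressed.
rewrite (invmx_eq (chi_mul_hat Ux lp lp')) lax_formE; congr ((_ - _) *m _).
rewrite (DopE l0 ql (is_mpd_chi mu Ux lp) (is_mderive_chi lp)).
rewrite /chi_pd /chi_dl scaler_sumr -big_split; apply: eq_bigr => k _ /=.
rewrite scalerA -addrA addrC -addrA -scalerDl scalerBr scalerA -scaleNr.
congr (_ + _ *: _).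
have n0 : l - p x k != 0 by rewrite subr_eq0.
have := flow_sub mu (quad_pole k Ux) ql; rewrite -/(g mu x k l).
move/eqP; rewrite subr_eq => /eqP ->.
by field; rewrite n0 ql.
Qed.

Lemma dressed_form_numerE mu x l : U x -> l \notin singular_points x ->
  dressed_form_numer mu x l = (\prod_k (l - p x k) * \prod_k (l - p' x k) * quad x l) *:
    dressed_form w Psi0 q0 u v mu l x.
Proof.
move=> Ux lS; have [l0 ql lp lp'] := singular_points_notin lS.
by rewrite dressed_formE // /dressed_form_numer dressed_numerE.
Qed.

Lemma dressed_form_numer_entry mu x l i j : U x -> l \notin singular_points x ->
  dressed_form_numer mu x l i j = (\prod_k (l - p x k) * \prod_k (l - p' x k) * quad x l) *
    dressed_form w Psi0 q0 u v mu l x i j.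
Proof. by move=> Ux lS; rewrite dressed_form_numerE // [LHS]mxE. Qed.

Lemma entire_quad x : entire (quad x).
Proof. by apply: entireD; [apply: entireX; exact: entire_id|exact: entire_cst]. Qed.

Lemma mentire_lax_numer (W : axis -> R * R -> 'M[C]_n) mu x : mentire (lax_numer W mu x).
Proof.
apply: mentireD; first exact: mentire_cst.
apply: mentireZ; last exact: mentire_cst.
by apply: entireM; [exact: entire_id|exact: entire_cst].
Qed.

Lemma mentire_dressed_form_numer mu x : mentire (dressed_form_numer mu x).
Proof.
apply: mentire_dressed_numer; [exact: entire_quad|exact: mentire_lax_numer|].
move=> k; rewrite /g /flow_slope; case: mu.
  apply: entireM; last exact: entire_cst.
  apply: entireM; first exact: entire_cst.
  apply: entireB; first exact: entire_cst.
  by apply: entireM; [exact: entire_id|exact: entire_cst].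
apply: entireM; last exact: entire_cst.
apply: entireM; first exact: entire_cst.
by apply: entireD; [exact: entire_id|exact: entire_cst].
Qed.

(** The reality condition [Omega(conj l)^H = - Gam Omega(l) Gam], from that of
    [Omega_0] and [D (X X') = 0]. *)
Lemma dressed_form_adj mu x l : U x -> l \notin singular_points x ->
  (dressed_form w Psi0 q0 u v mu l^*%R x) ^t* =
  - (Gam *m dressed_form w Psi0 q0 u v mu l x *m Gam).
Proof.
move=> Ux lS; have [l0 ql lp lp'] := singular_points_notin lS.
have [l0c qlc lpc lpc'] := singular_points_notin (singular_points_conj lS).
rewrite /dressed_form (invmx_eq (chi_mul_hat Ux lp lp')) (invmx_eq (chi_mul_hat Ux lpc lpc')).
rewrite (DopE l0 ql (is_mpd_chi mu Ux lp) (is_mderive_chi lp)) -/(chi_D mu x l).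
rewrite (DopE l0c qlc (is_mpd_chi mu Ux lpc) (is_mderive_chi lpc)) -/(chi_D mu x l^*%R).
rewrite -!/(X _ _) adjM chi_hat_adj adjD adjN adjM chi_adj.
have lax_real : (lax_form (current q0) mu l^*%R x) ^t* =
    - (Gam *m lax_form (current q0) mu l x *m Gam).
  by apply: lax_form_adj => nu; apply: current_real; exact: U_half.
rewrite lax_real.
have e := chi_D_hat mu Ux lp lp'.
set Y := lax_form (current q0) mu l x.
have GXG (Z : 'M[C]_n) : Gam *m X l x *m Gam *m Z = Gam *m (X l x *m (Gam *m Z *m Gam)) *m Gam.
  by rewrite !mulmxA -[_ *m Gam *m Gam]mulmxA GG mulmx1.
rewrite mulmxBr [X in _ - X]GXG e.
have -> : Gam *m - (chi_D mu x l *m X' l x) *m Gam = - (Gam *m (chi_D mu x l *m X' l x) *m Gam).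
  by rewrite mulmxN mulNmx.
rewrite opprK.
rewrite [X in _ = - X](_ : _ = Gam *m (X l x *m Y *m X' l x) *m Gam -
   Gam *m (chi_D mu x l *m X' l x) *m Gam); last first.
  by rewrite mulmxBl mulmxBr mulmxBl.
rewrite opprB addrC; congr (_ + _).
rewrite mulNmx mulmxN; congr (- _).
exact: sandwich3.
Qed.

Lemma dressed_form_numer_conj mu x k : U x -> dressed_form_numer mu x (p x k) = 0 -> dressed_form_numer mu x (p' x k) = 0.
Proof.
move=> Ux; apply: (entire_conj_root (E := singular_points x) GG); first exact: mentire_dressed_form_numer.
move=> l lS; rewrite !dressed_form_numerE ?singular_points_conj // adjZ dressed_form_adj // scalerN opprK.
rewrite sandwichZ; congr (_ *: _).
have h1 : (\prod_j (l^*%R - p x j))^*%R = \prod_j (l - p' x j).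
  by rewrite rmorph_prod; apply: eq_bigr => j _; rewrite rmorphB /= conjCK.
have h2 : (\prod_j (l^*%R - p' x j))^*%R = \prod_j (l - p x j).
  by rewrite rmorph_prod; apply: eq_bigr => j _; rewrite rmorphB /= conjCK /p' conjCK.
by rewrite !rmorphM /= quad_conj h1 h2 [X in _ = X * _]mulrC.
Qed.

(** At [lambda_k] the Lax form and the slope of [flow] cancel against the kernel
    condition; up to a non-zero factor, what remains is
    [u_k (d v_k)^H Psi_0k^-1 X' (lambda_k)]. *)
Lemma dressed_form_numer_pole mu x k : U x -> exists2 c : C, c != 0 &
  dressed_form_numer mu x (p x k) = c *: (u k x *m ((pd mu (v k) x) ^t* *m invmx (Psi0k w Psi0 k x)
     *m X' (p x k) x)).
Proof.
move=> Ux; have pp := poles_neq k _ Ux.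
rewrite /dressed_form_numer dressed_numer_at ?quad_pole //.
exists (- (\prod_(j | j != k) (p x k - p x j) * \prod_j (p x k - p' x j) * quad x (p x k))).
  have pinj : injective (p x) by apply: lam_inj; [exact: w_inj|exact: U_half|exact: U_slit].
  rewrite oppr_eq0 !mulf_neq0 ?quad_pole //.
    by apply: prod_sub_ne0 => j jk; apply: contra_neq jk => /pinj.
  by apply: prod_sub_ne0 => j _; exact: pp.
rewrite scaleNr -scalerN; congr (_ *: _).
rewrite -/(X' (p x k) x) mulmxDl -[in X in _ + X]scalemxAl residue_hat0 // scaler0 addr0.
rewrite -lax_formE residue_pdE // opprD addrCA subrr addr0.
rewrite mulNmx; congr (- _).
exact: mul_kernel (system_kernel k Ux).
Qed.

(** * The pole structure of the dressed form *)

Lemma dressed_form_numer_root x l : U x -> quad x l = 0 ->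
  dressed_form_numer Zed x l = (l / x.1%:C) *: dressed_form_numer Rho x l.
Proof.
move=> Ux ql; have r0 := rho_neq0 Ux.
rewrite /dressed_form_numer /dressed_numer scalemxAl; congr (_ *m _).
rewrite scalerBr scalemxAr /N0 lax_numer_root //; congr (_ - _).
rewrite scaler_sumr; apply: eq_bigr => k _.
rewrite [RHS]scalerA [X in _ = X *: _]mulrC -[RHS]scalerA; congr (_ *: _).
rewrite /g (flow_slope_root (p x k) r0 ql) ql; exact: slope_scale.
Qed.

(** The factors of the poles of [chi] and of its inverse. *)
Definition pole_prod x l : C := \prod_k (l - p x k) * \prod_k (l - p' x k).

Lemma entire_pole_prod x : entire (pole_prod x).
Proof. by apply: entireM; exact: entire_prod_sub. Qed.

(** The point [l = i rho]; with its opposite, the zeros of [quad]. *)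
Definition branch_point x : C := 'i%C * x.1%:C.

(** The current whose Lax form has the residues of the dressed form at
    [l = i rho] and [l = - i rho]. *)
Definition new_current mu x : 'M[C]_n :=
  let Mp := (pole_prod x (branch_point x))^-1 *: dressed_form_numer Rho x (branch_point x) in
  let Mm := (pole_prod x (- branch_point x))^-1 *: dressed_form_numer Rho x (- branch_point x) in
  match mu with
  | Rho => (2%:R * x.1%:C ^+ 2)^-1 *: (Mp + Mm)
  | Zed => (branch_point x / (2%:R * x.1%:C ^+ 3)) *: (Mp - Mm)
  end.

Lemma new_current_residue mu x l : U x -> quad x l = 0 ->
  pole_prod x l *: lax_numer new_current mu x l = dressed_form_numer mu x l.
Proof.
move=> Ux ql; have r0 := rho_neq0 Ux.
have n2 : 2%:R != 0 :> C by rewrite pnatr_eq0.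
have e2 : branch_point x ^+ 2 = - x.1%:C ^+ 2 by rewrite /branch_point exprMn sqr_i mulN1r.
have pp0 : pole_prod x l != 0.
  rewrite mulf_neq0 //; apply: prod_sub_ne0 => k _.
    by apply: contra_neq (quad_pole k Ux) => <-.
  by apply: contra_neq (quad_pole' k Ux) => <-.
have hl : l = branch_point x \/ l = - branch_point x.
  move/eqP: ql; rewrite quad_factor mulf_eq0 !subr_eq0.
  by case/orP => /eqP ->; [left|right].
suff hR : pole_prod x l *: lax_numer new_current Rho x l = dressed_form_numer Rho x l.
  case: mu; first exact: hR.
  rewrite (lax_numer_root new_current r0 ql) (dressed_form_numer_root Ux ql) -hR.
  by rewrite !scalerA mulrC.
suff -> : lax_numer new_current Rho x l = (pole_prod x l)^-1 *: dressed_form_numer Rho x l.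
  by rewrite scalerA divff // scale1r.
rewrite /lax_numer /= /new_current.
set Mp := _ *: dressed_form_numer Rho x (branch_point x); set Mm := _ *: dressed_form_numer Rho x (- branch_point x).
rewrite scalerN !scalerA.
have -> : x.1%:C ^+ 2 / (2%:R * x.1%:C ^+ 2) = 2%:R^-1 :> C by field; rewrite r0.
case: hl => ->; rewrite -/Mp -/Mm.
  have -> : branch_point x * x.1%:C * (branch_point x / (2%:R * x.1%:C ^+ 3)) = - 2%:R^-1.
    have -> : branch_point x * x.1%:C * (branch_point x / (2%:R * x.1%:C ^+ 3)) = branch_point x ^+ 2 / (2%:R * x.1%:C ^+ 2).
      by field; rewrite r0.
    by rewrite e2; field; rewrite r0.
  exact: half_sum.
have -> : - branch_point x * x.1%:C * (branch_point x / (2%:R * x.1%:C ^+ 3)) = 2%:R^-1.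
  have -> : - branch_point x * x.1%:C * (branch_point x / (2%:R * x.1%:C ^+ 3)) = - branch_point x ^+ 2 / (2%:R * x.1%:C ^+ 2).
    by field; rewrite r0.
  by rewrite e2; field; rewrite r0.
exact: half_diff.
Qed.

Lemma new_current_entry mu x l i j : U x -> quad x l = 0 ->
  dressed_form_numer mu x l i j = pole_prod x l * lax_numer new_current mu x l i j.
Proof. by move=> Ux ql; rewrite -new_current_residue // [LHS]mxE. Qed.

Lemma pole_structure_of_vanish :
  (forall x, U x -> forall mu k, dressed_form_numer mu x (p x k) = 0) ->
  lax_pole_structure U (dressed_form w Psi0 q0 u v).
Proof.
move=> T0; exists new_current => x Ux mu z i j.
(* The factor [l] accounts for the origin, which is in [singular_points] although
   neither form has a pole there. *)
pose t1 l := l * dressed_form_numer mu x l i j.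
pose t2 l := l * (pole_prod x l * lax_numer new_current mu x l i j).
apply: (@same_principal_parts R _ _ t1 t2 (singular_points x)); first exact: singular_points_uniq.
- by apply: entireM; [exact: entire_id|exact: mentire_dressed_form_numer].
- apply: entireM; first exact: entire_id.
  apply: entireM; last exact: mentire_lax_numer.
  exact: entire_pole_prod.
- move=> l lS; have [l0 ql lp lp'] := singular_points_notin lS.
  have pp0 : pole_prod x l != 0 by rewrite mulf_neq0 //; apply: prod_sub_ne0.
  rewrite /t1 dressed_form_numer_entry // singular_points_prod; exact: cancel_denoms.
- move=> l lS; have [l0 ql lp lp'] := singular_points_notin lS.
  have pp0 : pole_prod x l != 0 by rewrite mulf_neq0 //; apply: prod_sub_ne0.
  rewrite /t2 lax_form_entry singular_points_prod; exact: cancel_denoms2.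
- move=> e; rewrite /t1 /t2 /singular_points !mem_cat !inE.
  case/or3P => [/or3P[]/eqP->|/codomP[k ->]|/codomP[k ->]].
  + by rewrite !mul0r.
  + by rewrite new_current_entry // quad_factor subrr mul0r.
  + by rewrite new_current_entry // quad_factor [X in _ * X]subrr mulr0.
  + have -> : dressed_form_numer mu x (p x k) i j = 0 by rewrite T0 // [LHS]mxE.
    by rewrite /pole_prod prod_sub_eq0 !mul0r mulr0.
  + have -> : dressed_form_numer mu x (p' x k) i j = 0.
      by rewrite (dressed_form_numer_conj Ux (T0 _ Ux _ k)) [LHS]mxE.
    by rewrite /pole_prod (prod_sub_eq0 (p' x)) mulr0 !(mul0r, mulr0).
Qed.

(** The two forms have a common principal part at [lambda_k], and the Lax form is
    regular there; so the dressed form has a limit, and multiplying it by the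
    vanishing denominator gives [0]. *)
Lemma vanish_of_pole_structure :
  lax_pole_structure U (dressed_form w Psi0 q0 u v) ->
  forall x, U x -> forall mu k, dressed_form_numer mu x (p x k) = 0.
Proof.
move=> [W hW] x Ux mu k; apply/matrixP => i j; rewrite [RHS]mxE.
have [P [[_ _ c1] [_ _ c2]]] := hW x Ux mu (p x k) i j.
set f1 := fun l => dressed_form w Psi0 q0 u v mu l x i j in c1.
set f2 := fun l => lax_form W mu l x i j in c2.
have c3 : f2 l @[l --> (p x k)^'] --> f2 (p x k).
  apply: cvg_trans (_ : f2 l @[l --> p x k] --> f2 (p x k)).
    by apply: cvg_app; exact: cvg_within.
  have -> : f2 = fun l => (quad x l)^-1 * lax_numer W mu x l i j.
    by apply/funext => l; rewrite /f2 lax_form_entry.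
  have eN : entire (fun l => lax_numer W mu x l i j) by exact: mentire_lax_numer.
  have cN := entire_continuous eN; have cq := entire_continuous (@entire_quad x).
  have cqV : (quad x l)^-1 @[l --> p x k] --> (quad x (p x k))^-1.
    exact: (cvgV (quad_pole k Ux) (cq (p x k))).
  exact: (cvgM cqV (cN (p x k))).
have /cvg_ex[a ha] : cvg (f1 l @[l --> (p x k)^']).
  have -> : f1 = (fun l => (f1 l - P.[(l - p x k)^-1] - (f2 l - P.[(l - p x k)^-1])) + f2 l).
    by apply/funext => l; rewrite opprB addrACA [- _ + _]addrC; ring.
  have /cvg_ex[a1 h1] := c1; have /cvg_ex[a2 h2] := c2.
  apply/cvg_ex; exists (a1 - a2 + f2 (p x k)); exact: (cvgD (cvgB h1 h2) c3).
pose c l := pole_prod x l * quad x l.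
have ec : entire c.
  apply: entireM; last exact: entire_quad.
  exact: entire_pole_prod.
have cc : c l @[l --> (p x k)^'] --> c (p x k).
  have h := entire_continuous ec; apply: cvg_trans (h (p x k)).
  by apply: cvg_app; exact: cvg_within.
have ct : dressed_form_numer mu x l i j @[l --> (p x k)^'] --> dressed_form_numer mu x (p x k) i j.
  have eT : entire (fun l => dressed_form_numer mu x l i j) by exact: mentire_dressed_form_numer.
  have h := entire_continuous eT; apply: cvg_trans (h (p x k)).
  by apply: cvg_app; exact: cvg_within.
have c0 : c (p x k) = 0 by rewrite /c /pole_prod prod_sub_eq0 !mul0r.
have h := cvgM cc ha; rewrite c0 mul0r in h.
have h2 : dressed_form_numer mu x l i j @[l --> (p x k)^'] --> (0 : C).
  apply: cvg_trans (h _); apply: near_eq_cvg; near=> l.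
  by rewrite dressed_form_numer_entry //; near: l; exact: dnear_notin.
exact: (cvg_unique (@norm_hausdorff _ _) ct h2).
Unshelve. all: by end_near. Qed.

(** When the dressed form has the pole structure of a Lax form, the direction of
    [v_k] is infinitesimally constant. *)
Lemma pd_v_parallel :
  lax_pole_structure U (dressed_form w Psi0 q0 u v) ->
  forall x, U x -> forall mu k, exists a, pd mu (v k) x = a *: v k x.
Proof.
move=> hp x Ux mu k; have T0 := vanish_of_pole_structure hp Ux mu k.
have [c c0 e] := dressed_form_numer_pole mu k Ux.
have [_ _ u0 _] := data.1 x Ux k.
have Pu := Psi_unit Ux k.
set y := (pd mu (v k) x) ^t* *m invmx (Psi0k w Psi0 k x) in e.
have y0 : y *m X' (p x k) x = 0.
  move: e; rewrite T0 => /esym/eqP; rewrite scaler_eq0 (negPf c0) /= => /eqP e.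
  have [i ui] : exists i, u k x i 0 != 0.
    apply/existsP; apply: contraNT u0; rewrite negb_exists => /forallP h.
    apply/eqP/colP => i; rewrite mxE; apply/eqP; have := h i; by rewrite negbK.
  apply/rowP => j; rewrite [RHS]mxE.
  move/matrixP: e => /(_ i j); rewrite mxE big_ord1 [RHS]mxE => /eqP.
  by rewrite mulf_eq0 (negPf ui) /= => /eqP.
have [||| z zE] := @ker_unit_pfrac_residue _ _ _ (p x) (p' x) (A x) (B x) k y _ _ _ y0.
- by apply: lam_inj; [exact: w_inj|exact: U_half|exact: U_slit].
- by move=> i j; exact: poles_neq.
- by move=> l lp lp'; apply: mulmx1C; exact: chi_mul_hat.
have e2 : (pd mu (v k) x) ^t* = (z *m u k x) *m (v k x) ^t*.
  exact: row_parallel Pu zE.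
exists ((z *m u k x) 0 0)^*%R.
have e3 := congr1 (fun M : 'rV[C]_n => M ^t*) e2; rewrite adjK in e3.
rewrite e3 adjM adjK; apply/colP => i; rewrite mxE big_ord1 [RHS]mxE mulrC !mxE.
by [].
Qed.

End Dressing.

(** * Maps of constant direction *)

Section RealDifferentiability.
Context {R : realType}.
Local Notation C := R[i].
Implicit Types (f g : R * R -> C) (x y : R * R).

Lemma rdiffM f g x : rdiff f x -> rdiff g x -> rdiff (fun y => f y * g y) x.
Proof.
move=> [f1 f2] [g1 g2]; split.
  under eq_fun do rewrite cReM.
  by apply: differentiableB; apply: differentiableM.
under eq_fun do rewrite cImM.
by apply: differentiableD; apply: differentiableM.
Qed.

Lemma rdiff_cst (a : C) x : rdiff (fun=> a) x.
Proof. by split; apply: differentiable_cst. Qed.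

Lemma rdiff_conj f x : rdiff f x -> rdiff (fun y => (f y)^*%R) x.
Proof.
move=> [f1 f2]; split; first by under eq_fun do rewrite cRe_conj.
by under eq_fun do rewrite cIm_conj; apply: differentiableN.
Qed.

Lemma differentiable_normsq f x : rdiff f x ->
  differentiable (fun y => complex.Re (f y) ^+ 2 + complex.Im (f y) ^+ 2) x.
Proof.
move=> [f1 f2]; under eq_fun do rewrite !expr2.
by apply: differentiableD; apply: differentiableM.
Qed.

Lemma rdiffV f x : f x != 0 -> rdiff f x -> rdiff (fun y => (f y)^-1) x.
Proof.
move=> f0 fx; have n0 := normsq_ne0 f0; have nd := differentiable_normsq fx.
have nV := differentiableV nd n0; case: fx => f1 f2; split.
  under eq_fun do rewrite cReV; exact: (differentiableM f1 nV).
under eq_fun do rewrite cImV; apply: differentiableN; exact: (differentiableM f2 nV).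
Qed.

Lemma rdiff_near_neq0 f x : rdiff f x -> f x != 0 -> \forall y \near x, f y != 0.
Proof.
move=> fx f0; have n0 := normsq_ne0 f0.
pose Nf y := complex.Re (f y) ^+ 2 + complex.Im (f y) ^+ 2.
have N0 : 0 < Nf x by rewrite lt_neqAle eq_sym n0 addr_ge0 ?sqr_ge0.
have cN : Nf y @[y --> x] --> Nf x.
  by apply: differentiable_continuous; exact: differentiable_normsq.
apply: filterS (cvgr_gt _ cN _ N0) => y; rewrite /Nf; apply: contraTneq => ->.
by rewrite /= expr0n addr0 ltxx.
Qed.

(** A function on a ball whose partial derivatives vanish is constant. *)
Lemma partials0_cst (F : R * R -> R) x (r : R) y : ball x r y ->
  (forall z, ball x r z -> differentiable F z) ->
  (forall z mu, ball x r z -> 'D_(dir mu) F z = 0) -> F y = F x.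
Proof.
move=> By dF D0; pose d := y - x.
have inB (t : R) : 0 <= t <= 1 -> ball x r (t *: d + x).
  move=> /andP[t0 t1]; move: By; rewrite -!ball_normE /ball_ /= => By.
  rewrite opprD addrCA subrr addr0 normrN normrZ ger0_norm //.
  by apply: le_lt_trans By; rewrite /d distrC ler_piMl.
have dd z : ball x r z -> 'd F z d = 0.
  move=> Bz; have -> : d = d.1 *: dir Rho + d.2 *: dir Zed.
    apply: injective_projections; rewrite /= scaler0 ?addr0 ?add0r.
      by rewrite [_ *: _]mulr1.
    by rewrite [_ *: _]mulr1.
  have D1 := D0 z Rho Bz; have D2 := D0 z Zed Bz.
  rewrite (deriveE _ (dF z Bz)) in D1; rewrite (deriveE _ (dF z Bz)) in D2.
  by rewrite linearD !linearZ D1 D2 /= !scaler0 addr0.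
pose h (t : R) := F (t *: d + x).
have hd (t : R) : 0 <= t <= 1 -> is_derive t 1 h 0.
  move=> t01; have Bt := inB t t01.
  have dl : differentiable (fun t : R => t *: d + x) t by [].
  have dh : differentiable h t.
    by apply: (differentiable_comp (f := fun t : R => t *: d + x)) => //; exact: dF.
  split; first exact/derivable1_diffP.
  rewrite deriveE // /h (diff_comp (f := fun t : R => t *: d + x) (g := F)) //; last exact: dF.
  rewrite /comp.
  have -> : 'd (fun t : R => t *: d + x) t = (fun t : R => t *: d + 0) :> (R -> R * R).
    by rewrite diff_val.
  by rewrite /= addr0 scale1r dd.
have [||c _] := @MVT_segment R h (fun=> 0) 0 1 ler01.
- by move=> t; rewrite in_itv /= => /andP[t0 t1]; apply: hd; rewrite !ltW.
- apply: derivable_within_continuous => t; rewrite in_itv /= => t01.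
  by have [] := hd t t01.
- by rewrite mul0r /h scale1r scale0r add0r /d subrK => /eqP; rewrite subr_eq0 => /eqP.
Qed.
End RealDifferentiability.

Section ConstantDirection.
Context {R : realType} {n : nat}.
Local Notation C := R[i].
Variables (U : set (R * R)) (v : R * R -> 'cV[C]_n).
Hypothesis U_open : open U.
Hypothesis U_conn : connected U.
Hypothesis v_diff : forall x, U x -> mdiff v x.
Hypothesis v_neq0 : forall x, U x -> v x != 0.
Hypothesis v_par : forall x, U x -> forall mu, exists a, pd mu v x = a *: v x.

Lemma col_neq0 (c : 'cV[C]_n) : c != 0 -> exists i, c i 0 != 0.
Proof.
move=> c0; apply/existsP; apply: contraNT c0; rewrite negb_exists => /forallP h.
by apply/eqP/colP => i; rewrite mxE; apply/eqP; have := h i; rewrite negbK.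
Qed.

(** Near [x] the quotients of the entries of [v] by a non-zero one have zero
    derivatives. *)
Lemma locally_parallel x : U x -> \forall y \near x, U y /\ exists a, v y = a *: v x.
Proof.
move=> Ux; have [i vi] := col_neq0 (v_neq0 Ux).
have nv := rdiff_near_neq0 (v_diff Ux i 0) vi.
have nU : \forall y \near x, U y by apply: open_nbhs_nbhs.
have /nbhs_ballP[r /= r0 hr] : \forall y \near x, U y /\ v y i 0 != 0.
  by near=> y; split; near: y.
have nb : \forall y \near x, ball x r y by exact: nbhsx_ballx.
apply: filterS nb => y By; split; first by case: (hr _ By).
pose q j z := v z j 0 * (v z i 0)^-1.
have qd j z : ball x r z -> rdiff (q j) z.
  move=> /hr[Uz vz]; apply: rdiffM; first exact: v_diff.
  by apply: rdiffV => //; exact: v_diff.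
have q0 j z mu : ball x r z -> is_pdc mu (q j) z 0.
  move=> /hr[Uz vz]; have [a ha] := v_par Uz mu.
  have hv k : is_pdc mu (fun y => v y k 0) z (a * v z k 0).
    have := mdiff_is_mpd mu (v_diff Uz) k 0; by rewrite ha mxE.
  have := is_pdcM (hv j) (is_pdcV vz (hv i)).
  have -> : a * v z j 0 * (v z i 0)^-1 + v z j 0 * (- (v z i 0)^-1 * (a * v z i 0) * (v z i 0)^-1) = 0.
    by move: vz; set b := v z i 0 => vz; field.
  by [].
have qc j : q j y = q j x.
  apply: complex_eqP.
    apply: (@partials0_cst R (fun z => complex.Re (q j z)) x r y By).
      by move=> z /(qd j)[].
    by move=> z mu /(q0 j z mu)[h _]; rewrite derive_val.
  apply: (@partials0_cst R (fun z => complex.Im (q j z)) x r y By).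
    by move=> z /(qd j)[].
  by move=> z mu /(q0 j z mu)[_ h]; rewrite derive_val.
have [_ vy] := hr _ By.
exists (v y i 0 * (v x i 0)^-1); apply/colP => j; rewrite [RHS]mxE.
rewrite -mulrA [_^-1 * _]mulrC -[_ * _^-1]/(q j x) -qc /q.
by rewrite mulrCA divff // mulr1.
Unshelve. all: by end_near. Qed.


(** The points of [U] where [v] is parallel to [v x0] form an open and closed
    subset of [U]. *)
Lemma constant_direction x0 : U x0 -> forall x, U x -> exists a, v x = a *: v x0.
Proof.
move=> Ux0; pose par x := exists a, v x = a *: v x0.
have openP (P : R * R -> Prop) : (forall x, U x -> P x -> \forall y \near x, P y) ->
    open [set x | U x /\ P x].
  move=> hP; rewrite openE => x [Ux Px].
  have nU : \forall y \near x, U y by apply: open_nbhs_nbhs.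
  by apply: filterS2 nU (hP x Ux Px) => y Uy Py; split.
have o1 : open [set x | U x /\ par x].
  apply: openP => x Ux [a ha]; apply: filterS (locally_parallel Ux) => y [_ [b hb]].
  by exists (b * a); rewrite hb ha scalerA.
have o2 : open [set x | U x /\ ~ par x].
  apply: openP => x Ux nx; apply: filterS (locally_parallel Ux) => y [Uy [b hb]] [a ha].
  apply: nx; have b0 : b != 0.
    by apply: contraNneq (v_neq0 Uy) => b0; rewrite hb b0 scale0r.
  by exists (b^-1 * a); rewrite -scalerA -ha hb scalerA mulVf // scale1r.
have E : [set x | U x /\ par x] = U.
  apply: U_conn.
  - by exists x0; split => //; exists 1; rewrite scale1r.
  - by exists [set x | U x /\ par x] => //; apply/seteqP; split => [x [Ux px]|x [_ ]].
  - exists (~` [set x | U x /\ ~ par x]); first exact: open_closedC.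
    apply/seteqP; split => [x [Ux px]|x [Ux h]]; split => //.
      by case=> _; apply.
    by apply: contrapT => np; apply: h.
move=> x Ux; have h : [set x | U x /\ par x] x by rewrite E.
by case: h.
Qed.

End ConstantDirection.

(** * The Lax equation at the poles, and rescaling of the data *)

Section LaxSolutions.
Context {R : realType} {n N : nat}.
Local Notation C := R[i].

Lemma near_half_plane (x : R * R) : half_plane x -> \forall y \near x, half_plane y.
Proof.
move=> hx; have c1 : y.1 @[y --> x] --> x.1 by exact: cvg_fst.
exact: (cvgr_gt _ c1 _ hx).
Qed.

(** Along a pole the Lax equation becomes an ordinary equation for
    [Psi_0k = Psi_0(lambda_k(x), x)], because [d lambda_k = flow(lambda_k)]. *)
Lemma lax_solution_pole (H : set 'M[C]_n) q dom Psi0 (w : 'I_N -> C) x k mu :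
  lax_solution H q dom Psi0 ->
  (\forall y \near x, half_plane y /\ forall j, ~ slit y (w j)) ->
  dom (lam w k x, x) ->
  is_mpd mu (Psi0k w Psi0 k) x
    (- (lax_form (current q) mu (lam w k x) x *m Psi0k w Psi0 k x)).
Proof.
move=> [_ _ _ lax] hs hd; have [hx xs] := nbhs_singleton hs.
have [_ hm hder hD] := lax _ _ hd.
have l0 : lam w k x != 0 by exact: lam_neq0.
have q0 : lam w k x ^+ 2 + x.1%:C ^+ 2 != 0 by exact: lam_sqr_neq.
have e := hD l0 q0 mu; rewrite /Psi0k -e /Dop Dop_coefE // => i j.
have := @is_pdc_comp R mu (fun l y => Psi0 l y i j) (lam w k) x _ (hm i j) (hder i j) (is_pdc_lam hs mu k).
suff -> : (pd mu (Psi0 (lam w k x)) x -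
   - flow mu (lam w k x) x *: (\matrix_(i, j) (fun k0 => Psi0 k0 x i j)^`()%classic (lam w k x))) i j =
   pdc mu (fun y => Psi0 (lam w k x) y i j) x + flow mu (lam w k x) x * (fun l => Psi0 l x i j)^`()%classic (lam w k x) by [].
by rewrite scaleNr opprK !mxE.
Qed.

End LaxSolutions.

Section ConstantFamily.
Context {R : realType} {n N : nat}.
Local Notation C := R[i].
Variables (Gam : 'M[C]_n) (w : 'I_N -> C) (Psi0 : C -> R * R -> 'M[C]_n) (U : set (R * R)).

Lemma pd_const_family (c : 'I_N -> 'cV[C]_n) mu k x : pd mu (const_family Gam c k) x = 0.
Proof. exact: is_mpdE (is_mpd_cst mu (const_family Gam c k x) x). Qed.

(** Rescaling [v_k = phi_k v'_k] is absorbed in [u'_k = conj(phi_k) u_k]. *)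
Lemma rescale_family (u v v' : 'I_(N + N) -> R * R -> 'cV[C]_n) (phi : 'I_(N + N) -> R * R -> C) :
  (forall k x, U x -> rdiff (phi k) x) ->
  (forall k x, U x -> v k x = phi k x *: v' k x) ->
  (forall k x, U x -> mdiff (v' k) x) ->
  (forall x, U x -> forall k, v' (lshift N k) x = Gam *m v' (rshift N k) x) ->
  dressing_data Gam w Psi0 U u v ->
  let u' k x := (phi k x)^*%R *: u k x in
  dressing_data Gam w Psi0 U u' v' /\
  forall l x, U x -> chi w Psi0 u' v' l x = chi w Psi0 u v l x.
Proof.
move=> dphi ev dv' Gv' [d1 d2] u'.
have phi0 k x : U x -> phi k x != 0.
  move=> Ux; have [_ _ _ v0] := d1 x Ux k.
  by apply: contraNneq v0 => p0; rewrite ev // p0 scale0r.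
have uv k x : U x -> u' k x *m (v' k x) ^t* = u k x *m (v k x) ^t*.
  by move=> Ux; rewrite ev // /u' adjZ -scalemxAl -scalemxAr.
have vu k x : U x -> v' k x *m (u' k x) ^t* = v k x *m (u k x) ^t*.
  by move=> Ux; rewrite ev // /u' adjZ conjCK -scalemxAl -scalemxAr.
split; last first.
  move=> l x Ux; rewrite /chi; congr (_ + _); apply: eq_bigr => k _.
  by rewrite /dressing_residue uv.
split=> [x Ux k|x Ux].
  have [du dv u0 v0] := d1 x Ux k; split.
  - move=> i j; rewrite /u'; under eq_fun do rewrite mxE.
    by apply: rdiffM; [apply: rdiff_conj; exact: dphi|exact: du].
  - exact: dv'.
  - by rewrite /u' scaler_eq0 negb_or conjC_eq0 phi0.
  - by apply: contraNneq v0 => v'0; rewrite ev // v'0 scaler0.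
split=> [k|k]; first exact: Gv'.
have [_ /(_ k) sys] := d2 x Ux.
have p0 : (phi k x)^*%R != 0 by rewrite conjC_eq0 phi0.
apply: (scalerI p0); rewrite scalerN !scalemxAl -adjZ -ev // -sys scaler_sumr.
apply: eq_bigr => j _; rewrite scalerA mulrC -scalerA; congr (_ *: _).
rewrite -[in RHS]mulmxA -vu // [RHS]mulmxA !scalemxAl -adjZ -ev //.
Qed.

End ConstantFamily.

(** * The dressing theorem *)

Theorem theorem3 (R : realType) (n N : nat)
  (H : set 'M[R[i]]_n) (Gam : 'M[R[i]]_n)
  (q0 : R * R -> 'M[R[i]]_n)
  (dom : set (R[i] * (R * R))) (Psi0 : R[i] -> R * R -> 'M[R[i]]_n)
  (w : 'I_N -> R[i]) (U : set (R * R))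
  (H_semisimple : complex_semisimple_group H)
  (H_Gam : H Gam) (Gam_sqr : Gam *m Gam = 1%:M)
  (involutions : commuting_involutions Gam H)
  (K_maximal_compact :
     maximal_compact_subgroup (real_form Gam H) (isotropy Gam H))
  (q0_harmonic : axisymmetric_harmonic Gam H q0)
  (Psi0_lax : lax_solution H q0 dom Psi0)
  (w_inj : injective w) (w_upper : forall k, 0 < complex.Im (w k))
  (U_nonempty : U !=set0) (U_open : open U) (U_connected : connected U) (U_half : U `<=` half_plane)
  (U_slit : forall x, U x -> forall k, ~ slit x (w k))
  (Psi0_regular : forall x, U x -> forall k, dom (lam w k x, x)) :
  (forall (c : 'I_N -> 'cV[R[i]]_n) (u : 'I_(N + N) -> R * R -> 'cV[R[i]]_n),
     (forall k, c k != 0) ->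
     dressing_data Gam w Psi0 U u (const_family Gam c) ->
     lax_pole_structure U
       (dressed_form w Psi0 q0 u (const_family Gam c))) /\
  (forall u v : 'I_(N + N) -> R * R -> 'cV[R[i]]_n,
     dressing_data Gam w Psi0 U u v ->
     lax_pole_structure U (dressed_form w Psi0 q0 u v) ->
     exists (c : 'I_N -> 'cV[R[i]]_n)
            (u' : 'I_(N + N) -> R * R -> 'cV[R[i]]_n),
       [/\ forall k, c k != 0,
           dressing_data Gam w Psi0 U u' (const_family Gam c) &
           forall l x, U x ->
             chi w Psi0 u' (const_family Gam c) l x = chi w Psi0 u v l x]).
Proof.
have Hu : H `<=` [set A | A \in unitmx] by case: H_semisimple.1 => -[].
have Gh : Gam ^t* = Gam.
  apply: tau_involutive_hermitian => //; by case: (involutions _ H_Gam).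
have qform x : half_plane x -> q0 x \in unitmx /\ q0 x *m Gam *m (q0 x) ^t* = Gam.
  by move=> hx; have [qi _ _ _] := q0_harmonic x hx; exact: cartan_image_form qi.
have cur_real x : half_plane x -> forall mu,
    (current q0 mu x) ^t* = - (Gam *m current q0 mu x *m Gam).
  move=> hx mu; have [_ dq _ _] := q0_harmonic x hx; apply: current_adj => //.
  by apply: filterS (near_half_plane hx) => y; exact: qform.
have near_slit x : U x -> \forall y \near x, half_plane y /\ forall j, ~ slit y (w j).
  move=> Ux; have nU : \forall y \near x, U y by apply: open_nbhs_nbhs.
  by apply: filterS nU => y Uy; split; [exact: U_half|exact: U_slit].
have Psi_unit x : U x -> forall k, Psi0k w Psi0 k x \in unitmx.
  move=> Ux k; have [_ _ _ lax] := Psi0_lax.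
  by have [hH _ _ _] := lax _ _ (Psi0_regular x Ux k); exact: Hu.
have Psi_pd x : U x -> forall k mu, is_mpd mu (Psi0k w Psi0 k) x
    (- (lax_form (current q0) mu (lam w k x) x *m Psi0k w Psi0 k x)).
  move=> Ux k mu; apply: lax_solution_pole Psi0_lax (near_slit x Ux) _; exact: Psi0_regular.
split=> [c u c0 data|u v data hpole].
  apply: (pole_structure_of_vanish Gam_sqr Gh cur_real w_inj w_upper U_open U_half U_slit Psi_unit Psi_pd data).
  move=> x Ux mu k.
  have [a _ ->] := dressed_form_numer_pole Gam_sqr w_inj w_upper U_open U_half U_slit Psi_unit Psi_pd data mu k Ux.
  by rewrite pd_const_family adj0 !mul0mx mulmx0 scaler0.
(* The constants are the values at a base point [x0], and [phi] is read off a
   non-zero entry of [c]. *)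
have [x0 Ux0] := U_nonempty.
have vpar := pd_v_parallel Gam_sqr Gh w_inj w_upper U_open U_half U_slit Psi_unit Psi_pd data hpole.
have [d1 d2] := data.
pose c (k : 'I_N) := v (lshift N k) x0.
have c0 k : c k != 0 by have [] := d1 x0 Ux0 (lshift N k).
have [ii hii] := choice (fun k => col_neq0 (c0 k)).
pose phi (K : 'I_(N + N)) x := v (lshift N (base_index K)) x (ii (base_index K)) 0 *
   (c (base_index K) (ii (base_index K)) 0)^-1.
have vl (k : 'I_N) x : U x -> v (lshift N k) x =
    (v (lshift N k) x (ii k) 0 * (c k (ii k) 0)^-1) *: c k.
  move=> Ux; have [a ha] : exists a, v (lshift N k) x = a *: v (lshift N k) x0.
    apply: (@constant_direction R n U (v (lshift N k))) => //.
    - by move=> y Uy; have [] := d1 y Uy (lshift N k).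
    - by move=> y Uy; have [] := d1 y Uy (lshift N k).
    - by move=> y Uy mu; exact: vpar.
  have -> : v (lshift N k) x (ii k) 0 * (c k (ii k) 0)^-1 = a.
    by rewrite ha mxE -/(c k) mulfK.
  exact: ha.
have vphi K x : U x -> v K x = phi K x *: const_family Gam c K x.
  move=> Ux; rewrite /phi /base_index /const_family -[K in LHS]splitK.
  case: (fintype.split K) => k /=; first exact: vl.
  have [/(_ k) hG _] := d2 x Ux.
  by rewrite scalemxAr -vl // hG mulmxA Gam_sqr mul1mx.
have dphi K x : U x -> rdiff (phi K) x.
  move=> Ux; apply: rdiffM; last exact: rdiff_cst.
  by have [_ dv _ _] := d1 x Ux (lshift N (base_index K)); exact: dv.
have dcst K x : U x -> mdiff (const_family Gam c K) x.
  by move=> _ i j; exact: rdiff_cst.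
have cG x : U x -> forall k, const_family Gam c (lshift N k) x =
    Gam *m const_family Gam c (rshift N k) x.
  move=> _ k; rewrite /const_family.
  rewrite (_ : fintype.split (lshift N k) = inl k); last exact: (unsplitK (inl k)).
  rewrite (_ : fintype.split (rshift N k) = inr k); last exact: (unsplitK (inr k)).
  by rewrite mulmxA Gam_sqr mul1mx.
have [h1 h2] := rescale_family dphi vphi dcst cG data.
by exists c; eexists; split; [exact: c0|exact: h1|exact: h2].
Qed.
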